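(* Assume Martin's Axiom for $\omega_1$ dense sets, MA($\omega_1$). Then there is no $\mathbf{\Sigma}^1_2$ inextendible linearly ordered tower, no $\mathbf{\Sigma}^1_2$ mad family, no $\mathbf{\Sigma}^1_2$ maximal independent family, no $\mathbf{\Sigma}^1_2$ Hamel basis of $\mathbb{R}$, and no $\mathbf{\Sigma}^1_2$ non-principal ultrafilter on $\omega$.
   Context: For $x,y\in[\omega]^\omega$, $y\subseteq^* x$ means $y\setminus x$ is finite. An inextendible linearly ordered tower (ilt) is a set $X\subseteq[\omega]^\omega$ linearly ordered by $\subseteq^*$ with no infinite $z\subseteq\omega$ such that $z\subseteq^* x$ for all $x\in X$. A mad family is an infinite family of pairwise almost disjoint (finite intersection) elements of $[\omega]^\omega$ maximal under inclusion. A set $X\subseteq[\omega]^\omega$ is independent if for all finite disjoint $F,G\subseteq X$, $\bigcap_{x\in F}x\cap\bigcap_{y\in G}(\omega\setminus y)$ is infinite; it is maximal if maximal under inclusion. A Hamel basis of $\mathbb{R}$ is a maximal $\mathbb{Q}$-linearly independent subset of $\mathbb{R}$. *)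

(* Defs.v *)
From mathcomp Require Import all_boot all_order all_algebra.
From mathcomp Require Import all_classical all_reals topology cantor normedtype.

Set Implicit Arguments.
Unset Strict Implicit.
Unset Printing Implicit Defensive.

Import Order.TTheory GRing.Theory Num.Theory.
Import numFieldNormedType.Exports.

Local Open Scope classical_set_scope.
Local Open Scope ring_scope.

(** In a forcing notion, a smaller condition is stronger. *)

Definition compatible {d : Order.disp_t} {P : porderType d} (p q : P) : Prop :=
  exists r : P, (r <= p)%O /\ (r <= q)%O.

Definition antichain {d : Order.disp_t} {P : porderType d} (A : set P) : Prop :=
  forall p q : P, A p -> A q -> p <> q -> ~ compatible p q.

Definition ccc {d : Order.disp_t} (P : porderType d) : Prop :=
  forall A : set P, antichain A -> countable A.

Definition dense_poset {d : Order.disp_t} {P : porderType d} (D : set P) : Prop :=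
  forall p : P, exists2 q : P, D q & (q <= p)%O.

Definition filter_poset {d : Order.disp_t} {P : porderType d} (G : set P) : Prop :=
  [/\ G !=set0,
      forall p q : P, G p -> (p <= q)%O -> G q
    & forall p q : P, G p -> G q -> exists2 r : P, G r & (r <= p)%O /\ (r <= q)%O].

(** [W], ordered by [R], is a copy of the first uncountable ordinal; as [R] is
    reflexive, the set of predecessors of [w] below includes [w]. *)
Definition is_omega1 (W : Type) (R : rel W) : Prop :=
  [/\ wochoice.well_order R,
      ~ countable [set: W]
    & forall w : W, countable [set v | R v w]].

Definition MA_omega1 : Prop :=
  forall (W : Type) (R : rel W), is_omega1 R ->
  forall (d : Order.disp_t) (P : porderType d), [set: P] !=set0 -> ccc P ->
  forall D : W -> set P, (forall w, dense_poset (D w)) ->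
  exists2 G : set P, filter_poset G & forall w, G `&` D w !=set0.

(** Boldface projective classes, intended for Polish spaces [T]. *)

Notation baire_space := {ptws nat -> nat}.

Definition Sigma11 {T : topologicalType} (A : set T) : Prop :=
  exists2 C : set (T * baire_space), closed C & A = fst @` C.

Definition Pi11 {T : topologicalType} (A : set T) : Prop := Sigma11 (~` A).

Definition Sigma12 {T : topologicalType} (A : set T) : Prop :=
  exists2 B : set (T * baire_space), Pi11 B & A = fst @` B.

(** Families of subsets of [nat] are classified through characteristic
    functions, as subsets of the Cantor space. The infinite sets form a G_delta
    subset of it, so for families of infinite sets this is the same as being
    Sigma^1_2 in the Polish subspace of infinite sets. *)
Definition Sigma12_family (X : set (set nat)) : Prop :=
  Sigma12 [set c : cantor_space | X [set n | c n]].

Definition inclusion_maximal {T : Type} (P : set T -> Prop) (A : set T) : Prop :=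
  P A /\ forall B : set T, P B -> A `<=` B -> B = A.

Definition almost_subset (y x : set nat) : Prop := finite_set (y `\` x).

(** [almost_subset] is only a preorder, so linearity means comparability. *)
Definition ilt (X : set (set nat)) : Prop :=
  [/\ X `<=` [set x | infinite_set x],
      total_on X almost_subset
    & ~ exists2 z : set nat, infinite_set z & forall x, X x -> almost_subset z x].

Definition almost_disjoint_family (A : set (set nat)) : Prop :=
  [/\ infinite_set A,
      A `<=` [set x | infinite_set x]
    & forall x y : set nat, A x -> A y -> x <> y -> finite_set (x `&` y)].

Definition mad_family : set (set nat) -> Prop :=
  inclusion_maximal almost_disjoint_family.

Definition independent_family (X : set (set nat)) : Prop :=
  X `<=` [set x | infinite_set x] /\
  forall F G : set (set nat), finite_set F -> finite_set G ->
    F `<=` X -> G `<=` X -> F `&` G = set0 ->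
    infinite_set ((\bigcap_(x in F) x) `&` (\bigcap_(y in G) ~` y)).

Definition maximal_independent_family : set (set nat) -> Prop :=
  inclusion_maximal independent_family.

Definition rat_independent {R : realType} (H : set R) : Prop :=
  forall (s : seq R) (q : R -> rat), uniq s -> (forall x, x \in s -> H x) ->
    \sum_(x <- s) ratr (q x) * x = 0 -> forall x, x \in s -> q x = 0.

Definition Hamel_basis {R : realType} : set R -> Prop :=
  inclusion_maximal rat_independent.

Definition nonprincipal_ultrafilter (U : set (set nat)) : Prop :=
  UltraFilter U /\ forall n : nat, U <> principal_filter n.

(* Main.v *)
From HB Require Import structures.
From Stdlib Require List.
Require Import Defs.
From mathcomp Require Import ring lra.
From mathcomp Require Import all_boot all_order all_algebra.
From mathcomp Require Import all_classical all_reals topology cantor normedtype.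
Import Order.TTheory GRing.Theory Num.Theory.
Import numFieldNormedType.Exports.

(** A Sigma^1_2 set is aleph_1-Suslin: the Pi^1_1 condition says that a tree on [nat]
    is well-founded, which is witnessed by a rank function into omega_1.

    For ultrafilters, independent families and Hamel bases, MA(omega_1) for Cohen
    forcing says that the Cantor space is not a union of aleph_1 nowhere dense sets.
    An aleph_1-Suslin set that is not such a union is comeager, modulo such unions, in
    some box. For an ultrafilter, some point and its flip outside a finite set then
    both belong to it. For a Hamel basis containing [h0], the [h0]-coordinate of
    [h0 * \sum_(j | x j) 2^-j] would be constant on a comeager subset of a box, although
    changing one digit of [x] changes it. For a maximal independent family, infinitely
    many sets, any two of which have cofinite union, would avoid Boolean combinations
    with a common pattern of signs; these combinations would be pairwise almost
    disjoint, hence syntactically incompatible, and a pigeonhole argument excludes that.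

    For towers and mad families, bounding the rank functions by a countable ordinal
    splits the family into aleph_1 analytic pieces. Baire category in the square of a
    piece shows that an analytic set linearly ordered by almost inclusion has a
    countable coinitial subset, and that every set positive for the ideal generated by
    a mad family contains a positive one meeting only countably many members of a given
    analytic piece in an infinite set. In the second case the selectivity of the
    positive sets gives an almost decreasing tower of length omega_1 of such sets.
    In both cases MA(omega_1) for Mathias forcing with a filter generated by aleph_1
    sets yields a pseudointersection that contradicts inextendibility or maximality. *)

Set Implicit Arguments.
Unset Strict Implicit.
Unset Printing Implicit Defensive.

Local Open Scope classical_set_scope.
Local Open Scope nat_scope.

(** * Well-founded recursion, countable sets and infinite sets of numbers *)

Lemma wf_choice (T S : Type) (lt : T -> T -> Prop)
    (P : T -> (T -> S) -> S -> Prop) :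
  well_founded lt -> inhabited S ->
  (forall t f f' s, (forall u, lt u t -> f u = f' u) -> P t f s -> P t f' s) ->
  (forall t f, (forall u, lt u t -> P u f (f u)) -> exists s, P t f s) ->
  exists f, forall t, P t f (f t).
Proof.
move=> wf [s0] loc step.
pose F t (rec : forall u, lt u t -> S) :=
  (* Values outside the predecessors of [t] default to [s0]; [loc] makes them irrelevant to
     [P t]. *)
  let h u := if pselect (lt u t) is left p then rec u p else s0 in
  if pselect (exists s, P t h s) is left e then sval (cid e) else s0.
pose f := Fix wf (fun _ => S) F.
have fE t : f t = F t (fun u _ => f u).
  apply: Fix_eq => u g g' gg'; congr (F u _).
  by apply: functional_extensionality_dep => v; apply: funext => p.
exists f => t; elim/(well_founded_ind wf): t => t IH.
have [s Ps] := step t f IH.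
have hP : P t (fun u => if pselect (lt u t) is left p then f u else s0) s.
  by apply: loc Ps => u ut; case: pselect.
rewrite fE /F; case: pselect => [e|]; last by case; exists s.
by case: cid => r /= /(loc t _ f); apply => u ut; case: pselect.
Qed.

Lemma exists_injection (T : Type) (A : set T) : countable A ->
  exists f : T -> nat, forall x y, A x -> A y -> f x = f y -> x = y.
Proof.
by move=> /countable_injP[f finj]; exists f => x y Ax Ay; apply: finj; rewrite inE.
Qed.

Lemma injection_countable (T : Type) (A : set T) (f : T -> nat) :
  (forall x y, A x -> A y -> f x = f y -> x = y) -> countable A.
Proof.
by move=> finj; apply/countable_injP; exists f => x y; rewrite !inE; exact: finj.
Qed.

Lemma subset_countable (T : Type) (A B : set T) :
  A `<=` B -> countable B -> countable A.
Proof. by move=> AB; apply: sub_countable; apply: subset_card_le. Qed.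

Lemma countable_setU (T : Type) (A B : set T) :
  countable A -> countable B -> countable (A `|` B).
Proof.
move=> cA cB; apply: (@subset_countable _ _ (\bigcup_(b in [set: bool]) if b then A else B)).
  by move=> x [Ax|Bx]; [exists true|exists false].
by apply: bigcup_countable => // -[].
Qed.

Lemma countable_preimage (S T : Type) (f : S -> T) (B : set T) :
  injective f -> countable B -> countable (f @^-1` B).
Proof.
move=> finj /exists_injection[g ginj].
by apply: (@injection_countable _ _ (g \o f)) => x y Bx By /(ginj _ _ Bx By)/finj.
Qed.

Lemma countable_image (S T : Type) (f : S -> T) (A : set S) :
  countable A -> countable (f @` A).
Proof. by apply: sub_countable; apply: card_image_le. Qed.

Lemma countable_enum (T : Type) (A : set T) : countable A -> A !=set0 ->
  exists2 e : nat -> T, (forall n, A (e n)) & forall x, A x -> exists n, e n = x.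
Proof.
move=> /exists_injection[f finj] [a Aa].
pose e n := if pselect (exists2 x, A x & f x = n) is left p then s2val (cid2 p) else a.
exists e => [n|x Ax]; first by rewrite /e; case: pselect => // p; case: cid2.
exists (f x); rewrite /e; case: pselect => [p|[]]; last by exists x.
by case: cid2 => y Ay yx /=; exact: finj.
Qed.

Lemma countable_seqs (T : Type) (A : set T) :
  countable A -> countable [set s : seq T | all (fun x => `[<A x>]) s].
Proof.
move=> /exists_injection[f finj].
apply: (@injection_countable _ _ (fun s => pickle (map f s))) => s t /= sA tA.
move=> /(pcan_inj pickleK).
elim: s t sA tA => [[]//|x s IH [//|y t]] /= /andP[/asboolP Ax As] /andP[/asboolP Ay At].
by move=> [/(finj _ _ Ax Ay)-> /(IH _ As At)->].
Qed.

Lemma finite_bound (A : set nat) : finite_set A -> exists n, forall m, A m -> m < n.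
Proof.
move=> /finite_seqP[s ->]; exists (\max_(m <- s) m).+1 => m /= ms.
by rewrite ltnS; by apply: (@leq_bigmax_seq _ s xpredT id).
Qed.

Lemma bounded_finite (A : set nat) n : (forall m, A m -> m < n) -> finite_set A.
Proof. by move=> An; apply: (@sub_finite_set _ _ `I_n) => //; exact: finite_II. Qed.

Lemma infinite_natP (A : set nat) :
  infinite_set A <-> forall n, exists2 m, A m & n <= m.
Proof.
split=> [infA n|Aub /finite_bound[n An]].
  apply: contrapT => nm; apply: infA; apply: (@bounded_finite _ n) => m Am.
  by rewrite ltnNge; apply/negP => nm'; apply: nm; exists m.
by have [m /An] := Aub n; rewrite ltnNge => /negbTE->.
Qed.

(** * The first uncountable ordinal *)

Section FirstUncountable.
Variables (W : Type) (R : rel W).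
Hypothesis RW : is_omega1 R.

Lemma omega1_min (A : set W) : A !=set0 -> exists2 z, A z & forall x, A x -> R z x.
Proof.
move=> [a Aa]; case: RW => wo _ _.
have [|z [[/asboolP Az zmin] _]] := wo (fun x => `[<A x>]); first by exists a; apply/asboolP.
by exists z => // x Ax; apply: zmin; apply/asboolP.
Qed.

Lemma omega1_refl x : R x x.
Proof. by have [|z -> ->] := @omega1_min [set x]; first by exists x. Qed.

Lemma omega1_total x y : R x y \/ R y x.
Proof.
have [|z [->|->] zmin] := @omega1_min [set x; y]; first by exists x; left.
  by left; apply: zmin; right.
by right; apply: zmin; left.
Qed.

(** Antisymmetry comes from the uniqueness of minima: in the set of [x] and [y] both would be
    least. *)
Lemma omega1_anti x y : R x y -> R y x -> x = y.
Proof.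
move=> xy yx; case: RW => wo _ _.
have [|z [_ zu]] := wo (fun u => `[<u = x \/ u = y>]); first by exists x; apply/asboolP; left.
have -> : x = z; last have -> : y = z => //.
  by symmetry; apply: zu; split; [apply/asboolP; left|
    move=> u /asboolP[]-> //; apply: omega1_refl].
by symmetry; apply: zu; split; [apply/asboolP; right|
  move=> u /asboolP[]-> //; apply: omega1_refl].
Qed.

Lemma omega1_trans y x z : R x y -> R y z -> R x z.
Proof.
move=> xy yz.
have [|m mA mmin] := @omega1_min [set u | u = x \/ u = y \/ u = z]; first by exists x; left.
case: mA => [|[]] mE; subst m.
- by apply: mmin; right; right.
- by rewrite (@omega1_anti x y xy) //; apply: mmin; left.
- by rewrite -(@omega1_anti y z yz) //; apply: mmin; right; left.
Qed.

Definition below (x y : W) : Prop := ~ R y x.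

Lemma belowW x y : below x y -> R x y.
Proof. by move=> xy; case: (omega1_total x y). Qed.

Lemma wf_below : well_founded below.
Proof.
move=> x; apply: contrapT => nx.
have [|z nz zmin] := @omega1_min [set u | ~ Acc below u]; first by exists x.
by apply: nz; constructor => y yz; apply: contrapT => /zmin.
Qed.

(** Regularity of omega_1: an unbounded countable set would cover [W] by countably many countable
    initial segments. *)
Lemma countable_bounded (A : set W) : countable A -> exists w, forall a, A a -> below a w.
Proof.
move=> cA; apply: contrapT => /forallNP nb; case: RW => _ unc cpred; apply: unc.
apply: (@subset_countable _ _ (\bigcup_(a in A) [set v | R v a])); last exact: bigcup_countable.
by move=> w _; have /existsNP[a /not_implyP[Aa /contrapT wa]] := nb w; exists a.
Qed.

Lemma omega1_inhabited : inhabited W.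
Proof.
apply: contrapT => nW; case: RW => _ unc _; apply: unc.
by apply: (@subset_countable _ _ set0) => // x; case: nW.
Qed.

(** [small J] means that [J] has at most aleph_1 elements. *)
Definition small (J : Type) : Prop :=
  exists key : J -> W, forall w, countable [set j | R (key j) w].

Lemma small_omega1 : small W.
Proof. by exists id; case: RW. Qed.

Lemma small_countable (J : Type) : countable [set: J] -> small J.
Proof.
move=> cJ; have [w0] := omega1_inhabited; exists (fun=> w0) => w.
exact: subset_countable cJ.
Qed.

Let maxw v w := if R v w then w else v.

Let maxwP v w u : R (maxw v w) u -> R v u /\ R w u.
Proof.
rewrite /maxw; case: ifP => [vw wu|/negP vw vu]; split=> //.
  exact: omega1_trans wu.
by apply: omega1_trans vu; case: (omega1_total v w).
Qed.

Lemma small_prod (I J : Type) : small I -> small J -> small (I * J).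
Proof.
move=> [k kP] [l lP]; exists (fun p => maxw (k p.1) (l p.2)) => w.
apply: (@subset_countable _ _ ([set i | R (k i) w] `*` [set j | R (l j) w])).
  by move=> p /maxwP.
exact: countableX.
Qed.

Lemma small_sum (I J : Type) : small I -> small J -> small (I + J).
Proof.
move=> [k kP] [l lP].
exists (fun p => match p with inl i => k i | inr j => l j end) => w.
apply: (@subset_countable _ _ ((inl @` [set i | R (k i) w]) `|` (inr @` [set j | R (l j) w]))).
  by move=> [i|j] ?; [left; exists i|right; exists j].
by apply: countable_setU; apply: countable_image.
Qed.

Lemma small_seq (J : Type) : small J -> small (seq J).
Proof.
move=> [k kP]; have [w0] := omega1_inhabited.
exists (foldr (fun j w => maxw (k j) w) w0) => w.
apply: (@subset_countable _ _ [set s | all (fun j => `[<R (k j) w>]) s]).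
  by elim=> [//|j s IH] /= /maxwP[kj /IH ->]; rewrite andbT; apply/asboolP.
exact: (countable_seqs (kP w)).
Qed.

Definition lexi (p q : W * nat) : bool := R p.1 q.1 && (R q.1 p.1 ==> (p.2 <= q.2)).

(* The product with [nat] is again a copy of omega_1; this replaces the cardinal
   equality aleph_1 * aleph_0 = aleph_1. *)
Lemma lexi_omega1 : is_omega1 lexi.
Proof.
have anti p q : lexi p q -> lexi q p -> p = q.
  case: p q => [v m] [w n] /andP[/= vw mn] /andP[/= wv nm].
  rewrite (omega1_anti vw wv); congr pair; apply/eqP; rewrite eqn_leq.
  by rewrite (implyP mn) // (implyP nm).
case: RW => _ unc cpred; split.
- move=> A [[w n] An].
  have [|v [m Am] vmin] := @omega1_min [set v | exists n, (v, n) \in A]; first by exists w, n.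
  have exm : exists m, (v, m) \in A by exists m.
  have vmM : wochoice.minimum_of lexi A (v, ex_minn exm).
    case: ex_minnP => k Ak kmin; split => // -[u l] Au; apply/andP; split => /=.
      by apply: vmin; exists l.
    apply/implyP => uv; apply: kmin.
    by rewrite (@omega1_anti v u) //; apply: vmin; exists l.
  by exists (v, ex_minn exm); split => // q [qA qmin]; apply: anti;
    [apply: vmM.2|apply: qmin; apply: vmM.1].
- move=> c; apply: unc.
  apply: (@countable_preimage _ _ (fun w => (w, 0)) [set: W * nat]) => //.
  by move=> v w [].
- move=> [w n]; apply: (@subset_countable _ _ ([set v | R v w] `*` [set: nat])).
    by move=> q /andP[].
  exact: countableX.
Qed.

(** The code of an element is its key together with its number in the countable set of elements
    whose key is at most that one. *)
Lemma small_code (J : Type) : small J -> exists e : J -> W * nat, injective e.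
Proof.
move=> [key keyP].
have /choice[code codeP] : forall w, exists f : J -> nat,
    forall i j, R (key i) w -> R (key j) w -> f i = f j -> i = j.
  move=> w; have [f finj] := exists_injection (keyP w).
  by exists f => i j; exact: finj.
exists (fun j => (key j, code (key j) j)) => i j [kij].
by rewrite -kij => /codeP; apply; rewrite ?kij; apply: omega1_refl.
Qed.

End FirstUncountable.

(** A well-order of the Cantor space serves if its initial segments are countable; otherwise the
    strict predecessors of the least point with an uncountable initial segment serve. *)
Lemma exists_omega1 : exists (W : Type) (R : rel W), is_omega1 R.
Proof.
pose T : eqType := {classic (nat -> bool)}.
have [R wo] := wochoice.well_ordering_principle T.
have uncT : ~ countable [set: T].
  move=> /exists_injection[f finj].
  (* Cantor's diagonal: [g] would enumerate the Cantor space, but [d] differs from [g n] at [n]. *)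
  pose g n : nat -> bool :=
    if pselect (exists x : T, f x = n) is left p then sval (cid p) else xpred0.
  pose d : nat -> bool := fun n => ~~ g n n.
  have : g (f d) = d.
    rewrite /g; case: pselect => [p|[]]; last by exists d.
    by case: cid => x /= /finj->.
  by move=> /(congr1 (fun h => h (f d))); rewrite /d; case: (g _ _).
have wmin (A : set T) : A !=set0 -> exists2 z, A z & forall x, A x -> R z x.
  move=> [a Aa]; have [|z [[/asboolP Az zmin] _]] := wo (fun x => `[<A x>]).
    by exists a; apply/asboolP.
  by exists z => // x Ax; apply: zmin; apply/asboolP.
have [allc|/existsNP[t nt]] := pselect (forall t, countable [set v | R v t]).
  by exists T, R.
have [|z nz zmin] := wmin [set t | ~ countable [set v | R v t]]; first by exists t.
pose S := {v : T | `[<R v z /\ v <> z>]}.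
pose RS : rel S := fun u v => R (sval u) (sval v).
have inj : injective (fun u : S => sval u).
  by move=> u v /= uv; apply: val_inj.
exists S, RS; split.
- move=> A [a Aa].
  have [|m [/= mS mA] mmin] := wmin [set x | exists p : `[<R x z /\ x <> z>], exist _ x p \in A].
    by case: a Aa => x p Aa; exists x, p.
  exists (exist _ m mS); split; first split => //.
    by move=> -[x p] Ax; apply: mmin; exists p.
  move=> [x p] [Ax xmin]; apply: val_inj => /=.
  have [|y0 [_ zu]] := wo (fun u => `[<u = x \/ u = m>]); first by exists x; apply/asboolP; left.
  have refl u : R u u by have [|? -> ->] := wmin [set u]; first by exists u.
  have <- : y0 = m.
    apply: zu; split; first by apply/asboolP; right.
    move=> u /asboolP[]->; last exact: refl.
    by apply: mmin; exists p.
  apply: zu; split; first by apply/asboolP; left.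
  move=> u /asboolP[]->; first exact: refl.
  exact: (xmin (exist _ m mS)).
- move=> cS; apply: nz.
  apply: (@subset_countable _ _ ((fun u : S => sval u) @` [set: S] `|` [set z])).
    move=> v vz; have [->|vz'] := pselect (v = z); first by right.
    by left; exists (exist _ v (asboolT (conj vz vz'))).
  by apply: countable_setU => //; apply: countable_image.
- move=> [w p]; rewrite /RS /=.
  apply: (@countable_preimage _ _ (fun u : S => sval u) [set v | R v w]) => //.
  apply: contrapT => nw; have /asboolP[wz wz'] := p.
  have := zmin _ nw => zw; apply: wz'.
  have [|y0 [_ zu]] := wo (fun u => `[<u = w \/ u = z>]); first by exists w; apply/asboolP; left.
  have refl u : R u u by have [|? -> ->] := wmin [set u]; first by exists u.
  rewrite -(zu w) ?(zu z) //; split; try (apply/asboolP; by [left|right]);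
    by move=> u /asboolP[]->.
Qed.

(** * Consequences of Martin's Axiom *)

(* Principal down-sets turn a preorder into the partial order required by
   [MA_omega1]. *)
Definition principal_downset (P : Type) (le : P -> P -> Prop) :=
  {A : set P | `[<exists p, A = [set q | le q p]>]}.

HB.instance Definition _ (P : Type) (le : P -> P -> Prop) :=
  SubChoice.on (principal_downset le).
HB.instance Definition _ (P : Type) (le : P -> P -> Prop) :=
  [SubChoice_isSubPOrder of principal_downset le by <: with set_display].

Section MartinAxiom.
Hypothesis MA : MA_omega1.
Variables (W : Type) (R : rel W).
Hypothesis RW : is_omega1 R.

(** Equally coloured conditions are compatible, so colours separate the members of an antichain and
    the ccc holds. Coding [J] into [W * nat] turns the dense sets into a family to which [MA]
    applies. *)
Lemma MA_linked (J : Type) (P : Type) (p0 : P) (le : P -> P -> Prop)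
    (color : P -> nat) (D : J -> set P) :
  small R J -> (forall p, le p p) ->
  (forall p q r, le p q -> le q r -> le p r) ->
  (forall p q, color p = color q -> exists2 r, le r p & le r q) ->
  (forall j p, exists2 q, D j q & le q p) ->
  exists G : set P, (forall p q, G p -> G q -> exists r, [/\ G r, le r p & le r q]) /\
                    forall j, exists2 p, G p & D j p.
Proof.
move=> smallJ refl trans linked dense.
have [e einj] := small_code RW smallJ.
pose Q := principal_downset le.
pose d (p : P) : Q := exist _ [set q | le q p] (asboolT (ex_intro _ p erefl)).
have dP (A : Q) : exists p, A = d p.
  by case: A => A AP; have [p Ap] := asboolW AP; exists p; apply: val_inj.
have dle p q : (d p <= d q)%O <-> le p q.
  rewrite -Order.le_val /= subsetEset; split=> [/(_ p)|pq r /= rp]; first by apply; apply: refl.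
  exact: trans pq.
(* An index that codes no [j] gets the trivial dense set. *)
pose D' (w : W * nat) : set Q :=
  [set A | forall j, e j = w -> exists2 p, A = d p & D j p].
have [||w A|G [_ Gup Gdir] GD] := MA (lexi_omega1 RW) (P := Q) _ _ (D := D').
- by exists (d p0).
- move=> A Aanti; have /choice[c cP] := dP.
  apply: (@injection_countable _ _ (color \o c)) => a b Aa Ab /= /linked[r ra rb].
  apply: contrapT => ab; apply: (Aanti a b Aa Ab ab); exists (d r).
  by rewrite (cP a) (cP b); split; apply/dle.
- have [p ->] := dP A; have [[j jw]|nj] := pselect (exists j, e j = w).
    have [q Dq qp] := dense j p; exists (d q); last exact/dle.
    by move=> i iw; exists q => //; rewrite (einj i j) // iw.
  by exists (d p) => // j jw; case: nj; exists j.
exists [set p | G (d p)]; split.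
  move=> p q Gp Gq; have [A GA [Ap Aq]] := Gdir _ _ Gp Gq.
  have [r rE] := dP A; subst A; exists r; split => //; exact/dle.
by move=> j; have [A [GA /(_ j erefl)[p pE Dp]]] := GD (e j); exists p; rewrite //= -pE.
Qed.

(** Mathias forcing: a condition is a finite stem with a finite list of promises, obeyed by all
    elements added to the stem later. Conditions with equal stems are compatible, so the stem is the
    colour. *)
Lemma pseudointersection (J : Type) (B : J -> set nat) : small R J ->
  (forall s : seq J, infinite_set [set n | forall j, List.In j s -> B j n]) ->
  exists2 z, infinite_set z & forall j, almost_subset z (B j).
Proof.
move=> smallJ fip.
pose le (p q : seq nat * seq J) :=
  [/\ forall n, n \in q.1 -> n \in p.1, forall j, List.In j q.2 -> List.In j p.2 &
    forall n, n \in p.1 -> n \notin q.1 -> forall j, List.In j q.2 -> B j n].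
have refl p : le p p by split => // n ->.
pose D (i : J + nat) : set (seq nat * seq J) := fun p =>
  match i with inl j => List.In j p.2 | inr n => exists2 m, m \in p.1 & n <= m end.
have [||p q r [a1 a2 a3] [b1 b2 b3]|p q|i [s F]|G [Gdir GD]] :=
  @MA_linked (J + nat) _ ([::], [::]) le (fun p => pickle p.1) D.
- by apply: small_sum => //; apply: small_countable => //; exact: countableP.
- exact: refl.
- split=> [n /b1/a1|j /b2/a2|n np nr j jr] //.
  case: (boolP (n \in q.1)) => nq; first exact: b3 nq nr j jr.
  by apply: a3 np nq j (b2 _ jr).
- move=> /(pcan_inj pickleK) pq; exists (p.1, p.2 ++ q.2); split => //=.
  + by move=> j jp; apply/List.in_app_iff; left.
  + by move=> n ->.
  + by move=> n; rewrite pq.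
  + by move=> j jp; apply/List.in_app_iff; right.
  + by move=> n np; rewrite -pq np.
- case: i => [j|n].
    by exists (s, j :: F); [left|split => //= [i Fi|n ->//]; right].
  have [m Bm nm] := (infinite_natP _).1 (fip F) n.
  exists (m :: s, F); first by exists m; rewrite //= inE eqxx.
  split=> //= [k ks|k]; first by rewrite inE ks orbT.
  by rewrite inE => /orP[/eqP-> _ //|->].
exists [set n | exists2 p, G p & n \in p.1].
  apply/infinite_natP => n; have [[t F] Gt [m /= mt nm]] := GD (inr n).
  by exists m => //; exists (t, F).
move=> j; have [p Gp pj] := GD (inl j).
apply: (@sub_finite_set _ _ [set` p.1]); last exact: finite_seq.
(* An element outside [B j] must already be in the stem of [p], which promises [j]: a common
   extension with [q] cannot break this promise. *)
move=> n [[q Gq nq] nB] /=; apply: contrapT => /negP np.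
have [r [Gr [r1 r2 r3] [t1 t2 t3]]] := Gdir p q Gp Gq.
by apply: nB; apply: r3 np j pj; exact: t1.
Qed.

End MartinAxiom.

(** * Category in the Cantor space *)

Definition agree (T : Type) (n : nat) (x y : nat -> T) : Prop :=
  forall k, k < n -> x k = y k.

Lemma agree_refl T n (x : nat -> T) : agree n x x. Proof. by []. Qed.

Lemma agree_sym T n (x y : nat -> T) : agree n x y -> agree n y x.
Proof. by move=> xy k /xy. Qed.

Lemma agree_trans T n (x y z : nat -> T) : agree n x y -> agree n y z -> agree n x z.
Proof. by move=> xy yz k kn; rewrite xy // yz. Qed.

Lemma agree_leq T m n (x y : nat -> T) : m <= n -> agree n x y -> agree m x y.
Proof. by move=> mn xy k km; apply: xy; exact: leq_trans mn. Qed.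

Lemma agree_mkseq T n (x y : nat -> T) : mkseq x n = mkseq y n <-> agree n x y.
Proof.
split=> [xy k kn|xy].
  by have := congr1 (fun s => nth (x k) s k) xy; rewrite /= !nth_mkseq.
by apply/eq_in_map => k; rewrite mem_iota; exact: xy.
Qed.

Lemma mkseqS T (x : nat -> T) n : mkseq x n.+1 = rcons (mkseq x n) (x n).
Proof. by rewrite /mkseq -addn1 iotaD map_cat cats1. Qed.

(** Closed subsets of the product of countably many copies of a discrete space. *)
Definition sclosed (B : Type) (Phi : (nat -> B) -> Prop) : Prop :=
  forall u, ~ Phi u -> exists n, forall v, agree n u v -> ~ Phi v.

Lemma sclosed_forall B (I : Type) (Phi : I -> (nat -> B) -> Prop) :
  (forall i, sclosed (Phi i)) -> sclosed (fun u => forall i, Phi i u).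
Proof.
move=> cl u /existsNP[i /cl[n nP]]; exists n => v /nP uv vP.
exact: uv (vP i).
Qed.

Lemma sclosed_and B (Phi Psi : (nat -> B) -> Prop) :
  sclosed Phi -> sclosed Psi -> sclosed (fun u => Phi u /\ Psi u).
Proof.
move=> cP cQ u /not_andP[/cP|/cQ] [n nP]; exists n => v /nP uv [vP vQ]; exact: uv.
Qed.

Lemma sclosed_local B (Phi : (nat -> B) -> Prop) n :
  (forall u v, agree n u v -> Phi u -> Phi v) -> sclosed Phi.
Proof. by move=> loc u nu; exists n => v uv /(loc _ _ (agree_sym uv)). Qed.

Lemma sclosed_imp B (P : Prop) (Phi : (nat -> B) -> Prop) :
  sclosed Phi -> sclosed (fun u => P -> Phi u).
Proof.
by move=> cl u /not_implyP[p /cl[n nP]]; exists n => v /nP uv vP; apply: uv (vP p).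
Qed.

Lemma sclosed_comp B C (r : nat -> nat) (b : B -> C) (Phi : (nat -> C) -> Prop) :
  sclosed Phi -> sclosed (fun u => Phi (fun k => b (u (r k)))).
Proof.
move=> cl u /cl[n nP]; exists (\max_(k < n) r k).+1 => v uv; apply: nP => k kn.
by rewrite uv // ltnS; apply: (leq_bigmax (Ordinal kn)).
Qed.

Definition open_dense (D : set (nat -> bool)) : Prop :=
  (forall x, D x -> exists n, forall y, agree n x y -> D y) /\
  (forall x n, exists2 y, D y & agree n x y).

Section Category.
Variables (W : Type) (R : rel W).
Hypothesis RW : is_omega1 R.

(** Unions of aleph_1 many nowhere dense subsets of the Cantor space. *)
Definition meager (A : set (nat -> bool)) : Prop :=
  exists2 D : W * nat -> set (nat -> bool),
    (forall i, open_dense (D i)) & forall x, (forall i, D i x) -> ~ A x.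

Lemma meagerW (A B : set (nat -> bool)) : A `<=` B -> meager B -> meager A.
Proof. by move=> AB [D oD DB]; exists D => // x /DB Bx /AB. Qed.

Lemma open_denseT : open_dense setT.
Proof. by split=> [x _|x n]; [exists 0|exists x]. Qed.

Lemma meager_small (J : Type) (D : J -> set (nat -> bool)) (A : set (nat -> bool)) :
  small R J -> (forall j, open_dense (D j)) ->
  (forall x, (forall j, D j x) -> ~ A x) -> meager A.
Proof.
move=> smallJ oD DA; have [e einj] := small_code RW smallJ.
exists (fun i x => forall j, e j = i -> D j x) => [i|x Dx].
  have [[j ji]|nj] := pselect (exists j, e j = i).
    rewrite (_ : (fun _ => _) = D j) //.
    apply: funext => x; apply: propext; split=> [|Dx k ki]; first exact.
    by rewrite (einj k j) // ki.
  rewrite (_ : (fun _ => _) = setT); first exact: open_denseT.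
  by apply: funext => x; apply: propext; split=> // _ j ji; case: nj; exists j.
by apply: DA => j; apply: Dx.
Qed.

Lemma meager_bigcup (J : Type) (A : J -> set (nat -> bool)) :
  small R J -> (forall j, meager (A j)) -> meager (\bigcup_j A j).
Proof.
move=> smallJ mA.
have /choice[D DP] : forall j, exists D : W * nat -> set (nat -> bool),
    (forall i, open_dense (D i)) /\ forall x, (forall i, D i x) -> ~ A j x.
  by move=> j; have [D] := mA j; exists D.
apply: (@meager_small (J * (W * nat)) (fun p => D p.1 p.2)).
- apply: small_prod => //; apply: small_prod => //; first exact: small_omega1.
  by apply: small_countable => //; exact: countableP.
- by move=> p; exact: (DP p.1).1.
- by move=> x Dx [j _]; apply: (DP j).2 => i; exact: (Dx (j, i)).
Qed.

Lemma meager_setU (A B : set (nat -> bool)) : meager A -> meager B -> meager (A `|` B).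
Proof.
move=> mA mB; apply: (@meagerW _ (\bigcup_(b in [set: bool]) if b then A else B)).
  by move=> x [Ax|Bx]; [exists true|exists false].
apply: meager_bigcup => [|[]//]; apply: small_countable => //; exact: countableP.
Qed.

Lemma meager0 : meager set0.
Proof. by exists (fun=> setT) => [i|x _ []]; exact: open_denseT. Qed.

(** The hypotheses make preimages of open dense sets open dense: [theta] is continuous, and the
    image of every box contains a box. *)
Lemma meager_preimage (theta : (nat -> bool) -> nat -> bool) (A : set (nat -> bool)) :
  (forall x n, exists m, forall y, agree m x y -> agree n (theta x) (theta y)) ->
  (forall x n, exists2 y, agree n x y & exists m, forall z, agree m (theta y) z ->
     exists2 t, agree n x t & theta t = z) ->
  meager A -> meager (theta @^-1` A).
Proof.
move=> cont opn [D oD DA]; exists (fun i => theta @^-1` D i) => [i|x Dx]; last exact: DA.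
split=> [x /(oD i).1[n nD]|x n].
  by have [m mP] := cont x n; exists m => y /mP/nD.
have [y xy [m mP]] := opn x n.
by have [z Dz /mP[t xt tz]] := (oD i).2 (theta y) m; exists t; rewrite //= tz.
Qed.

(** * Category for aleph_1-Suslin sets *)

Section Suslin.
Variables (K : Type) (Phi : (nat -> bool * K) -> Prop).
Hypotheses (smallK : small R K) (clPhi : sclosed Phi).

Let above (t : seq K) : set (nat -> bool) :=
  [set x | exists2 f, mkseq f (size t) = t & Phi (fun k => (x k, f k))].

Let null t x n := meager [set y | agree n x y /\ above t y].

Let nullW t x y m n : m <= n -> agree m x y -> null t x m -> null t y n.
Proof.
move=> mn xy; apply: meagerW => z [/(agree_leq mn) yz tz].
by split => //; exact: agree_trans yz.
Qed.

(** There are only countably many boxes, so the boxes where [above t] is meager contribute a meager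
    set altogether. *)
Let meager_null t : meager [set y | above t y /\ exists n, null t y n].
Proof.
apply: (@meagerW _ (\bigcup_(s : seq bool)
    [set y | [/\ above t y, mkseq y (size s) = s & null t y (size s)]])).
  by move=> y [ty [n yn]]; exists (mkseq y n) => //; split; rewrite ?size_mkseq.
apply: meager_bigcup; first by apply: small_countable => //; exact: countableP.
move=> s; have [[y0 [_ ys yn]]|none] := pselect ([set y | [/\ above t y,
    mkseq y (size s) = s & null t y (size s)]] !=set0); last first.
  by apply: meagerW meager0 => y ty; apply: none; exists y.
apply: meagerW yn => y [ty yss _]; split => //.
by apply/agree_mkseq; rewrite ys.
Qed.

Let nowhere_null t x n := forall y m, agree n x y -> ~ null t y m.

(** The hypothesis makes the null boxes dense in the given box; outside their union only a nowhere
    dense set is left. *)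
Let meager_not_null t x n :
  (forall y, agree n x y -> forall m, ~ nowhere_null t y m) ->
  null t x n.
Proof.
move=> dns; pose D := [set y | agree n x y -> exists m, null t y m].
have oD : open_dense D.
  split=> [y Dy|y m].
    have [xy|nxy] := pselect (agree n x y); last first.
      by exists n => z yz xz; case: nxy; apply: agree_trans (agree_sym yz).
    by have [m ym] := Dy xy; exists m => z yz _; exists m; exact: nullW ym.
  have [xy|nxy] := pselect (agree n x y); last by exists y.
  have /existsNP[z /existsNP[k /not_implyP[yz /contrapT zk]]] := dns y xy m.
  by exists z => // _; exists k.
apply: (@meagerW _ ([set y | above t y /\ exists n, null t y n] `|` ~` D)).
  move=> y [xy ty]; have [Dy|nDy] := pselect (D y); last by right.
  by left; split => //; exact: Dy.
apply: meager_setU; first exact: meager_null.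
by exists (fun=> D) => // y Dy; apply; case: (omega1_inhabited RW) => w; exact: (Dy (w, 0)).
Qed.

Let decided t : set (nat -> bool) :=
  [set x | exists n, null t x n \/ exists k, nowhere_null (rcons t k) x n].

(** In a box without decided points every [above (rcons t k)] would be meager, hence also their
    union [above t], as [K] has at most aleph_1 elements; this would decide [t]. *)
Let open_dense_decided t : open_dense (decided t).
Proof.
split=> [x [n [xn|[k xk]]]|x n].
- by exists n => y xy; exists n; left; exact: nullW xn.
- exists n => y xy; exists n; right; exists k => z m yz.
  by apply: xk; exact: agree_trans yz.
apply: contrapT => nD; apply: (nD); exists x => //; exists n; left.
apply: (@meagerW _ (\bigcup_k [set y | agree n x y /\ above (rcons t k) y])).
  move=> y [xy [f ft Pf]]; exists (f (size t)) => //; split => //.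
  by exists f => //; rewrite size_rcons mkseqS ft.
apply: meager_bigcup => // k; apply: meager_not_null => y xy m ym; apply: nD.
by exists y => //; exists m; right; exists k.
Qed.

(* Nonmeager aleph_1-Suslin sets are comeager somewhere: a point [y] of a box in
   which no sub-box is null, and which lies in all the dense open sets [decided t],
   determines step by step a witness for its membership. *)
Lemma suslin_comeager (A : set (nat -> bool)) :
  (forall x, A x <-> exists f, Phi (fun k => (x k, f k))) ->
  ~ meager A -> exists x n, meager [set y | agree n x y /\ ~ A y].
Proof.
move=> AE nA.
have [x [n xn]] : exists x n, nowhere_null [::] x n.
  apply: contrapT => none; apply: nA.
  apply: (@meagerW _ [set y | agree 0 xpredT y /\ above [::] y]).
    by move=> y /AE[f Pf]; split => //; exists f.
  by apply: meager_not_null => y _ m ym; apply: none; exists y, m.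
exists x, n; apply: (@meager_small _ decided) => [||y Dy [xy] nAy]; first exact: small_seq.
  exact: open_dense_decided.
(* A live node is not null near [y]; as [y] decides it, one of its one-step extensions is live. *)
pose live t := exists m, nowhere_null t y m.
have /choice[kappa kP] : forall t, exists k, live t -> live (rcons t k).
  move=> t; have [[m ym]|nl] := pselect (live t).
    have [l [/ym|[k yk]]] := Dy t; first by case.
    by exists k => _; exists l.
  (* An empty [K] would make [A] empty, hence meager. *)
  by have [|k0] := pselect (inhabited K); [case=> k0; exists k0|
    case: nA; apply: (meagerW _ meager0) => z /AE[f _]; case: k0; split; exact: f 0].
pose t := fix t n := if n is n'.+1 then rcons (t n') (kappa (t n')) else [::].
pose f n := kappa (t n).
have ft l : mkseq f l = t l by elim: l => // l IH; rewrite mkseqS IH.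
have lt l : live (t l).
  elim: l => [|l IH]; last exact: kP.
  by exists n => z m yz; apply: xn; exact: agree_trans yz.
(* If [f] were no witness, closedness would exclude all witnesses extending [t l] over a box around
   [y], against liveness. *)
apply: nAy; apply/AE; exists f; apply: contrapT => /clPhi[l lP].
have [m ym] := lt l; apply: (ym y (maxn m l)) => //; apply: meagerW meager0 => z [yz [g gt Pg]].
have st : size (t l) = l by rewrite -ft size_mkseq.
move: gt; rewrite st -ft => /agree_mkseq gf.
by apply: (lP _ _ Pg) => k kl; rewrite yz ?gf // (leq_trans kl) // leq_maxr.
Qed.

End Suslin.

Hypothesis MA : MA_omega1.

(** Cohen forcing inside the box: the conditions are finite strings continuing the first [n] digits
    of [x], and each is its own colour. *)
Lemma meager_generic (A : set (nat -> bool)) x n :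
  meager A -> exists2 y, agree n x y & ~ A y.
Proof.
move=> [D oD DA].
pose box (s : seq bool) : set (nat -> bool) :=
  [set y | agree n x y /\ forall k, k < size s -> y (n + k) = nth false s k].
pose E (i : W * nat + nat) (s : seq bool) : Prop :=
  match i with inl j => forall y, box s y -> D j y | inr k => k < size s end.
have [||s t r ts rt|s t|i s|G [Gdir GE]] :=
  @MA_linked MA _ _ RW (W * nat + nat) _ [::] (fun s t => prefix t s) pickle E.
- by apply: small_sum => //; [apply: small_prod => //; first exact: small_omega1|];
    apply: small_countable => //; exact: countableP.
- exact: prefix_refl.
- exact: prefix_trans rt ts.
- by move=> /(pcan_inj pickleK)->; exists t; exact: prefix_refl.
- case: i => [j|k]; last first.
    exists (s ++ nseq k.+1 false); last exact: prefix_prefix.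
    by rewrite /E size_cat size_nseq addnS ltnS leq_addl.
  pose y0 k := if k < n then x k else nth false s (k - n).
  have [y Dy y0y] := (oD j).2 y0 (n + size s).
  have [m mP] := (oD j).1 y Dy.
  exists (s ++ mkseq (fun k => y (n + size s + k)) m); last exact: prefix_prefix.
  move=> z [xz sz]; apply: mP => k km.
  have [kn|nk] := ltnP k n.
    by rewrite -xz // -y0y /y0 ?kn //; exact: leq_trans (leq_addr _ _).
  have := sz (k - n); rewrite subnKC // size_cat size_mkseq.
  have [kns|kns] := ltnP (k - n) (size s).
    move=> ->; last by rewrite ltn_addr.
    rewrite nth_cat kns -y0y; first by rewrite /y0 ltnNge nk.
    by rewrite -ltn_subLR.
  move=> ->; last by rewrite ltn_addl // (leq_ltn_trans _ km) // leq_subr.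
  rewrite nth_cat [k - n < _]ltnNge kns /= nth_mkseq.
    by rewrite -addnA subnKC // subnKC.
  by rewrite (leq_ltn_trans _ km) // (leq_trans (leq_subr _ _)) ?leq_subr.
have /choice[p pP] : forall k, exists p, G p /\ k < size p.
  by move=> k; have [p] := GE (inr k); exists p.
pose y k := if k < n then x k else nth false (p (k - n)) (k - n).
exists y => [k kn|]; first by rewrite /y kn.
apply: DA => j; have [q Gq] := GE (inl j); apply; split=> [k kn|k kq].
  by rewrite /y kn.
rewrite /y ltnNge leq_addr /= addKn; have [Gk kp] := pP k.
have [r [_ /prefixP[r1 ->]]] := Gdir _ _ Gk Gq.
move=> /prefixP[r2] /(congr1 (fun s => nth false s k)).
by rewrite !nth_cat kp kq.
Qed.

End Category.

(** * Suslin representations of Sigma^1_2 sets *)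

(** The sets containing a cylinder at [y] form a filter converging pointwise to [y], so it contains
    every neighbourhood. *)
Lemma ptws_nbhs (V : uniformType) (y : {ptws nat -> V}) (A : set {ptws nat -> V}) :
  nbhs y A -> exists m, forall z, agree m y z -> A z.
Proof.
pose F : set_system {ptws nat -> V} := [set A | exists m, forall z, agree m y z -> A z].
have FF : Filter F.
  split; first by exists 0.
    move=> P Q [m mP] [n nQ]; exists (maxn m n) => z yz; split.
      by apply: mP; exact: agree_leq (leq_maxl _ _) yz.
    by apply: nQ; exact: agree_leq (leq_maxr _ _) yz.
  by move=> P Q PQ [m mP]; exists m => z /mP/PQ.
have : {ptws, F --> y}.
  apply/(@pointwise_cvgP nat V F y FF) => t U /nbhs_singleton Uy.
  by exists t.+1 => z yz; rewrite /= -yz.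
by move=> /(_ A).
Qed.

Section SuslinRepresentation.
Variables (W : Type) (R : rel W).
Hypothesis RW : is_omega1 R.
Variables (T : topologicalType) (A : Type) (app : nat -> (nat -> A) -> set T).
Hypothesis app_local : forall m c d, agree m c d -> app m c `<=` app m d.

(** The sets [app m c] contain [h] and shrink to it. Coding points in this way treats the Cantor
    space and the reals together. *)
Definition names (c : nat -> A) (h : T) : Prop :=
  (forall m, app m c h) /\
  forall U, nbhs h U -> exists m, forall n, m <= n -> app n c `<=` U.

(* The components of the witness are a point [y] of the Baire space and a rank
   function into [W] for the tree of attempts to build a branch through the closed
   set at [(h, y)]. *)
Lemma Sigma12_suslin (X : set T) : Sigma12 X ->
  exists2 Phi : (nat -> A * (nat * W)) -> Prop, sclosed Phi &
    forall c h, names c h -> (X h <-> exists f, Phi (fun k => (c k, f k))).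
Proof.
move=> [B [C clC BC] XB].
(* A node is realised by a point of [C] over approximations of [h] and [y], so membership of [s]
   reads only [size s] entries of [c] and [y]. *)
pose tree (c : nat -> A) (y : nat -> nat) (s : seq nat) : Prop :=
  exists (h : T) (z w : nat -> nat),
    [/\ app (size s) c h, agree (size s) y z, mkseq w (size s) = s & C ((h, z), w)].
pose ext (t s : seq nat) := prefix s t && (size s < size t).
pose rk (u : nat -> A * (nat * W)) (s : seq nat) := (u (pickle s)).2.2.
exists (fun u => forall p : seq nat * seq nat, ext p.2 p.1 ->
    tree (fst \o u) (fun k => (u k).2.1) p.1 ->
    tree (fst \o u) (fun k => (u k).2.1) p.2 -> below R (rk u p.2) (rk u p.1)).
  apply: sclosed_forall => -[s t].
  pose N := maxn (maxn (size s) (size t)) (maxn (pickle s).+1 (pickle t).+1).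
  apply: (@sclosed_local _ _ N) => u v uv uP st.
  have tr r : size r <= N -> tree (fst \o v) (fun k => (v k).2.1) r ->
      tree (fst \o u) (fun k => (u k).2.1) r.
    move=> rN [h [z [w [ch yz ws Chz]]]]; exists h, z, w; split=> //.
      by apply: app_local ch => k kr; rewrite /= uv // (leq_trans kr).
    by move=> k kr; rewrite uv ?yz // (leq_trans kr).
  have [sN tN] : size s <= N /\ size t <= N by rewrite !leq_max !leqnn !orbT.
  move=> /(tr _ sN) us /(tr _ tN) ut; have := uP st us ut.
  by rewrite /rk /= !uv // /N !leq_max !ltnSn !orbT.
move=> c h [ch chU]; split; last first.
  move=> [f fP]; rewrite XB; exists (h, fun k => (f k).1) => //.
  apply: contrapT => nB.
  have [[p w] Cw pE] : (fst @` C) (h, fun k => (f k).1) by rewrite -BC.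
  move: pE Cw => /= -> Cw.
  have tw n : tree c (fun k => (f k).1) (mkseq w n).
    by exists h, (fun k => (f k).1), w; rewrite size_mkseq.
  (* Along a branch [w] the ranks would descend forever in [W]. *)
  pose r n := (f (pickle (mkseq w n))).2.
  have rdec n : below R (r n.+1) (r n).
    apply: (fP (mkseq w n, mkseq w n.+1)); [|exact: tw|exact: tw].
    by rewrite /ext [_.1]/= [_.2]/= !size_mkseq ltnSn mkseqS prefix_rcons.
  have : forall v n, r n <> v.
    elim/(well_founded_ind (wf_below RW)) => v IH n rn.
    by apply: (IH (r n.+1) _ n.+1); rewrite // -rn.
  by move=> /(_ (r 0) 0).
rewrite XB => -[[p y] By /= ph]; rewrite {p}ph in By.
(* As [(h, y)] is outside the projection of [C], finite approximations separate each [w] from [C];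
   hence the tree has no infinite branch. *)
have sep (w : baire_space) : exists m, forall n h' (z w' : baire_space),
    m <= n -> app n c h' -> agree n y z -> agree n w w' -> ~ C ((h', z), w').
  have : nbhs (((h, y), w) : (T * baire_space * baire_space)%type) (~` C).
    apply: open_nbhs_nbhs; split; first exact: closed_openC.
    move=> Cw; suff : (~` B) (h, y) by [].
    by rewrite BC; exists ((h, y), w).
  move=> [[U V] /= [[[U1 U2] /= [nU1 nU2] U12] nV] UV].
  have [k kP] := chU _ nU1; have [l lP] := ptws_nbhs nU2; have [m mP] := ptws_nbhs nV.
  exists (maxn k (maxn l m)) => n h' z w'; rewrite !geq_max => /and3P[kn ln mn] h'n yz ww' Ch.
  apply: (UV ((h', z), w')) Ch; split => /=.
    by apply: (U12 (h', z)); split; [exact: kP h'n|apply: lP; exact: agree_leq yz].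
  by apply: mP; exact: agree_leq ww'.
pose lt t s := [/\ ext t s, tree c y t & tree c y s].
have wf_lt : well_founded lt.
  move=> s0; apply: contrapT => s0n.
  pose S := {s | ~ Acc lt s}.
  have /choice[nx nxP] : forall s : S, exists t : S, lt (sval t) (sval s).
    move=> [s sn]; apply: contrapT => none; apply: (sn); constructor => t ts.
    by apply: contrapT => tn; apply: none; exists (exist _ t tn).
  pose s_ n := sval (iter n nx (exist _ s0 s0n)).
  have s_P n : lt (s_ n.+1) (s_ n) by exact: nxP.
  have s_size n : n <= size (s_ n).
    by elim: n => // n IH; have [/andP[_ /(leq_ltn_trans IH)]] := s_P n.
  have s_pre m n : m <= n -> prefix (s_ m) (s_ n).
    elim: n => [|n IH]; first by rewrite leqn0 => /eqP->; exact: prefix_refl.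
    rewrite leq_eqVlt => /orP[/eqP->|/IH mn]; first exact: prefix_refl.
    by have [/andP[nn _] _ _] := s_P n; exact: prefix_trans mn nn.
  have s_nth m n k : k < size (s_ m) -> m <= n -> nth 0 (s_ m) k = nth 0 (s_ n) k.
    by move=> km /s_pre/prefixP[r ->]; rewrite nth_cat km.
  pose w k := nth 0 (s_ k.+1) k.
  have [m mP] := sep w; have [_ _ [h' [z [w' [h'n yz w's Ch]]]]] := s_P m.
  apply: mP Ch; [exact: s_size|exact: h'n|exact: yz|] => k km.
  rewrite -[w' k](@nth_mkseq _ 0 w' (size (s_ m))) // w's /w.
  case: (leqP m k.+1) => [/(s_nth _ _ _ km)|/ltnW /(s_nth _ _ _ (s_size k.+1))] -> //.
have [g gP] : exists g : seq nat -> W, forall s t, lt t s -> below R (g t) (g s).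
  apply: (@wf_choice _ _ lt (fun s g v => forall t, lt t s -> below R (g t) v) wf_lt).
    exact: (omega1_inhabited RW).
    by move=> s f f' v ff' fP t ts; rewrite -ff' //; exact: fP.
  (* There are only countably many finite sequences, so all values of [f] have a common strict
     bound. *)
  move=> s f _; have [|v vP] := @countable_bounded _ _ RW (f @` setT).
    by apply: countable_image.
  by exists v => t _; apply: vP; exists t.
exists (fun k => (y k, odflt (g [::]) (omap g (unpickle k)))) => -[s t] st ts tt.
by rewrite /rk !pickleK; apply: gP; split.
Qed.
End SuslinRepresentation.

(** * Ultrafilters *)

Section BooleanFamilies.
Hypothesis MA : MA_omega1.
Variables (W : Type) (R : rel W).
Hypothesis RW : is_omega1 R.

Lemma Sigma12_family_suslin (X : set (set nat)) : Sigma12_family X ->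
  exists2 Phi : (nat -> bool * (nat * W)) -> Prop, sclosed Phi &
    forall x : nat -> bool, X [set n | x n] <-> exists f, Phi (fun k => (x k, f k)).
Proof.
pose app m (x : nat -> bool) : set cantor_space := [set y | agree m x y].
move=> /(@Sigma12_suslin _ _ RW cantor_space bool app) [|Phi cl PhiX].
  by move=> m c d cd x cx; exact: agree_trans (agree_sym cd) cx.
exists Phi => // x; apply: PhiX; split=> [//|U /ptws_nbhs[m mU]].
by exists m => n mn y /(agree_leq mn)/mU.
Qed.

Lemma small_witness : small R (nat * W).
Proof.
by apply: small_prod => //; [apply: small_countable => //; exact: countableP|exact: small_omega1].
Qed.


Lemma nonmeager_cover (J : Type) (A : J -> set (nat -> bool)) :
  small R J -> (forall x, exists j, A j x) -> exists j, ~ meager W (A j).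
Proof.
move=> smallJ cov; apply: contrapT => /forallNP nA.
have mU : meager W (\bigcup_j A j).
  by apply: (meager_bigcup RW) => // j; apply: contrapT; exact: nA.
have [y _] := meager_generic RW MA xpredT 0 mU; apply.
by have [j Ay] := cov y; exists j.
Qed.

Lemma meager_flip (m : nat -> bool) (A : set (nat -> bool)) :
  meager W A -> meager W [set x | A (fun k => x k (+) m k)].
Proof.
apply: (@meager_preimage _ (fun x k => x k (+) m k)) => [x n|x n].
  by exists n => y xy k kn; rewrite xy.
exists x => //; exists n => z xz; exists (fun k => z k (+) m k).
  by move=> k kn; rewrite -xz // addbK.
by apply: funext => k; rewrite addbK.
Qed.

(** The complement of each singleton is in [U], hence so are all final segments, and these exclude
    bounded sets. *)
Lemma ultrafilter_infinite (U : set (set nat)) (A : set nat) :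
  nonprincipal_ultrafilter U -> U A -> infinite_set A.
Proof.
move=> [UU Unp] UA /finite_bound[N AN].
have Upt n : U (~` [set n]).
  have [Un|//] := in_ultra_setVsetC [set n] UU.
  case: (Unp n); apply/seteqP; split=> [B UB|B /principal_filterP nB].
    apply/principal_filterP; apply: contrapT => nB; apply: (@filter_not_empty _ U).
    rewrite (_ : set0 = B `&` [set n]); first exact: filterI.
    by apply/seteqP; split=> // m [Bm /= mn]; apply: nB; rewrite -mn.
  by apply: filterS Un => m ->; exact: nB.
have UN : forall n, U [set m | n <= m].
  elim=> [|n IH]; first by apply: filterS filterT.
  apply: filterS (filterI IH (Upt n)) => m [/= nm mn].
  by rewrite ltn_neqAle nm andbT eq_sym; apply/eqP.
apply: (@filter_not_empty _ U); apply: filterS (filterI (UN N) UA) => m [/= Nm /AN].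
by rewrite ltnNge Nm.
Qed.

Lemma no_Sigma12_ultrafilter :
  ~ exists U : set (set nat), Sigma12_family U /\ nonprincipal_ultrafilter U.
Proof.
move=> [U [/Sigma12_family_suslin[Phi cl PhiU] npU]]; have [UU _] := npU.
pose V : set (nat -> bool) := [set x | U [set n | x n]].
have nV : ~ meager W V.
  have [||b nb] := @nonmeager_cover bool
    (fun b => if b then V else [set x | V (fun k => x k (+) true)]).
  - by apply: small_countable => //; exact: countableP.
  - move=> x; have [Ux|Ux] := in_ultra_setVsetC [set n | x n] UU; first by exists true.
    exists false; move: Ux; congr (U _); apply/seteqP.
    by split=> n /=; rewrite addbT; move/negP.
  - by move=> mV; apply: nb; case: b => //; exact: (meager_flip (fun=> true)).
have [x [n mxn]] := suslin_comeager RW small_witness cl PhiU nV.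
(* Flipping all digits from [n] on preserves the box, so a generic point and its flip both lie in
   [V], yet they are disjoint beyond [n]. *)
have [y xy] := meager_generic RW MA x n
  (meager_setU RW mxn (meager_flip (fun k => n <= k) mxn)).
move=> /not_orP[/not_andP[//|/contrapT Vy] /not_andP[[]|/contrapT Vfy]].
  by move=> k kn; rewrite leqNgt kn addbF xy.
apply: (ultrafilter_infinite npU (filterI Vy Vfy)).
apply: (@bounded_finite _ n) => k [/= yk]; rewrite yk.
by case: leqP.
Qed.

End BooleanFamilies.

(** * Maximal independent families *)

(* Infinitely many pairwise incompatible finite partial functions of bounded size do
   not exist: [a i k] is the [k]-th argument of the [i]-th one, [eps k] its value. *)
Lemma finite_incompatible (S : Type) (eps : nat -> bool) (a : nat -> nat -> S)
    (L : seq nat) (Z : set nat) : infinite_set Z ->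
  (forall i k l, Z i -> k \in L -> l \in L -> eps k <> eps l -> a i k <> a i l) ->
  ~ (forall i j, Z i -> Z j -> i <> j ->
      exists k l, [/\ k \in L, l \in L, eps k <> eps l & a i k = a j l]).
Proof.
have [n] := ubnP (size L); elim: n L Z => // n IH L Z; rewrite ltnS => Ln Zinf sep inc.
have [i0 Zi0 _] := (infinite_natP Z).1 Zinf 0.
pose C (p : nat * nat) := [set i | [/\ Z i, i0 <> i, eps p.1 <> eps p.2 & a i0 p.1 = a i p.2]].
(* Pigeonhole: one pair of positions makes infinitely many functions incompatible with the one of
   index [i0]. *)
have [[k l] [kL lL Cinf]] : exists p : nat * nat, [/\ p.1 \in L, p.2 \in L & infinite_set (C p)].
  apply: contrapT => none; apply: (infinite_setD Zinf (finite_set1 i0)).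
  apply: (@sub_finite_set _ _
      (\bigcup_(p in [set` [seq (k, l) | k <- L, l <- L]]) C p)).
    move=> i [Zi /= ii0]; have i0i : i0 <> i by move=> e; apply: ii0.
    have [k [l [kL lL kl akl]]] := inc i0 i Zi0 Zi i0i.
    by exists (k, l) => //=; apply/allpairsP; exists (k, l).
  apply: bigcup_finite; first exact: finite_seq.
  move=> p /= /allpairsP[[k l] /= [kL lL ->]]; apply: contrapT => inf.
  by apply: none; exists (k, l).
apply: (IH [seq h <- L | h != l] (C (k, l))) => //.
- apply: leq_trans Ln; rewrite size_filter -(count_predC (pred1 l) L) -addn1 addnC.
  by rewrite leq_add2r -has_count; apply/hasP; exists l => //=.
- move=> i h h' [Zi _ _ _]; rewrite !mem_filter => /andP[_ hL] /andP[_ h'L].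
  exact: sep.
- move=> i j [Zi _ kl al] [Zj _ _ al'] ij.
  have [h [h' [hL h'L hh' ahh']]] := inc i j Zi Zj ij.
  rewrite /= in kl al al'.
  exists h, h'; rewrite !mem_filter hL h'L !andbT; split=> //; apply/eqP => e; subst.
    by apply: (sep j l h' Zj lL h'L hh'); rewrite -al' al.
  by apply: (sep i h l Zi hL lL hh'); rewrite ahh' -al' al.
Qed.

Definition slot (i k : nat) : nat := CodeSeq.code [:: i; k].

Arguments slot : simpl never.

Definition unslot (c : nat) : nat * nat :=
  (nth 0 (CodeSeq.decode c) 0, nth 0 (CodeSeq.decode c) 1).

Lemma slotK i k : unslot (slot i k) = (i, k).
Proof. by rewrite /unslot /slot CodeSeq.codeK. Qed.

Lemma slot_geq i k : i <= slot i k.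
Proof. by have /andP[/ltnW] := CodeSeq.ltn_code [:: i; k]. Qed.

Section MaximalIndependent.
Hypothesis MA : MA_omega1.
Variables (W : Type) (R : rel W).
Hypothesis RW : is_omega1 R.
Variable I : set (set nat).
Hypothesis indI : independent_family I.

(** The Boolean combination of members [a 0, a 1, ...] of [I] prescribed by the sign
    sequence [eps] is disjoint from [x] beyond [j]. *)
Definition avoids (eps : seq bool) (x : nat -> bool) (a : nat -> nat -> bool) (j : nat) :=
  [/\ forall i, i < size eps -> I [set n | a i n],
      forall i l, i < size eps -> l < size eps ->
        nth false eps i <> nth false eps l -> a i <> a l
    & forall n, j <= n -> x n ->
        ~ forall i, i < size eps -> a i n = nth false eps i].

Lemma finite_avoids (x : nat -> bool) (F G : set (set nat)) :
  finite_set F -> finite_set G -> F `<=` I -> G `<=` I -> F `&` G = set0 ->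
  finite_set ([set n | x n] `&` ((\bigcap_(y in F) y) `&` (\bigcap_(y in G) ~` y))) ->
  exists eps a j, avoids eps x a j.
Proof.
move=> /finite_seqP[s ->] /finite_seqP[t ->] sI tI st /finite_bound[j jP].
pose eps := nseq (size s) true ++ nseq (size t) false.
have epsE i : i < size eps -> nth false eps i = (i < size s).
  rewrite size_cat nth_cat !size_nseq !nth_nseq; case: (ltnP i (size s)) => // _ _.
  by case: (_ < _).
pose a i n := `[<nth set0 (s ++ t) i n>].
have aE i : [set n | a i n] = nth set0 (s ++ t) i.
  by apply/seteqP; split=> n /asboolP.
have sz : size eps = size s + size t by rewrite size_cat !size_nseq.
have tP i : i < size eps -> (i < size s) = false -> nth set0 (s ++ t) i \in t.
  rewrite sz nth_cat => it si; rewrite si mem_nth //.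
  by rewrite -(ltn_add2l (size s)) subnKC // leqNgt si.
have sP i : i < size s -> nth set0 (s ++ t) i \in s.
  by move=> si; rewrite nth_cat si mem_nth.
exists eps, a, j; split.
- move=> i ie; rewrite aE; case: (ltnP i (size s)) => si; first by apply: sI; exact: sP.
  by apply: tI; apply: tP => //; rewrite ltnNge si.
- have half i l : i < size eps -> l < size eps -> i < size s ->
      (l < size s) = false -> a i <> a l.
    move=> ie le si sl ail.
    suff : ([set` s] `&` [set` t]) (nth set0 (s ++ t) i) by rewrite st.
    split=> /=; first exact: sP.
    by rewrite -aE ail aE; exact: tP.
  move=> i l ie le; rewrite !epsE //.
  case si : (i < size s); case sl : (l < size s) => // _; first exact: half.
  by move=> ail; exact: (half l i).
- move=> n jn xn all_a; move: jn; apply/negP; rewrite -ltnNge; apply: jP; split=> //.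
  split=> y /= ys.
    have ys' : index y s < size eps by rewrite sz ltn_addr // index_mem.
    move: (all_a _ ys'); rewrite epsE // index_mem ys => /asboolP.
    by rewrite nth_cat index_mem ys nth_index.
  have yt' : size s + index y t < size eps by rewrite sz ltn_add2l index_mem.
  move: (all_a _ yt'); rewrite epsE // ltnNge leq_addr /= => /negP ny yn.
  apply: ny; apply/asboolP.
  by rewrite nth_cat ltnNge leq_addr /= addKn nth_index.
Qed.

(** A finite [x] avoids the empty combination, and a member of [I] avoids its own complement. Any
    other [x] destroys independence when added, and the failing combination uses [x] or its
    complement. *)
Lemma avoids_cover (x : nat -> bool) : maximal_independent_family I ->
  exists eps a j, avoids eps x a j \/ avoids eps (fun k => x k (+) true) a j.
Proof.
move=> [_ Imax]; pose X := [set n | x n].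
have left_ : (exists eps a j, avoids eps x a j) ->
    exists eps a j, avoids eps x a j \/ avoids eps (fun k => x k (+) true) a j.
  by move=> [eps [a [j av]]]; exists eps, a, j; left.
have [finX|infX] := pselect (finite_set X).
  apply: left_; apply: (@finite_avoids x set0 set0) => //; first exact: set0I.
  by apply: sub_finite_set finX => n [].
have [IX|nIX] := pselect (I X).
  apply: left_; apply: (@finite_avoids x set0 [set X]) => //; try exact: set0I.
    by move=> _ ->.
  by apply: (@sub_finite_set _ _ set0) => // n [xn [_ /(_ X erefl)]].
have [Iinf Iind] := indI.
pose B := I `|` [set X].
have nB : ~ independent_family B.
  by move=> iB; apply: nIX; rewrite -(Imax B iB); [right|move=> y; left].
have [F [G [finF [finG [FB [GB [FG fin]]]]]]] : exists F G, finite_set F /\ finite_set G /\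
    F `<=` B /\ G `<=` B /\ F `&` G = set0 /\
    finite_set ((\bigcap_(x in F) x) `&` (\bigcap_(y in G) ~` y)).
  apply: contrapT => none; apply: nB; split=> [y [/Iinf//|->//]|F G fF fG FB GB FG fin].
  by apply: none; exists F, G.
have inI (H : set (set nat)) : H `<=` B -> H `\ X `<=` I.
  by move=> HB y [/HB[//|->] []].
have [FX|nFX] := pselect (F X).
  apply: left_; apply: (@finite_avoids x (F `\ X) G) => //.
  - exact: finite_setD.
  - exact: inI.
  - move=> y Gy; have [//|yX] := GB y Gy.
    suff : (F `&` G) X by rewrite FG.
    by split => //; rewrite -yX.
  - by apply/seteqP; split=> // y [[Fy _] Gy]; rewrite -FG.
  - apply: sub_finite_set fin => n [xn [nF nG]]; split=> // y Fy.
    by have [->//|yX] := pselect (y = X); apply: nF.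
have FI : F `<=` I by move=> y Fy; have [//|yX] := FB y Fy; case: nFX; rewrite -yX.
have [GX|nGX] := pselect (G X).
  have [|||eps [a [j av]]] :=
    @finite_avoids (fun k => x k (+) true) F (G `\ X) finF _ FI (inI _ GB).
  - exact: finite_setD.
  - by apply/seteqP; split=> // y [Fy [Gy _]]; rewrite -FG.
  - apply: sub_finite_set fin => n [/= xn [nF nG]]; split=> // y Gy.
    have [->|yX] := pselect (y = X); last by apply: nG.
    by move: xn; rewrite addbT => /negP.
  by exists eps, a, j; right.
have GI : G `<=` I by move=> y Gy; have [//|yX] := GB y Gy; case: nGX; rewrite -yX.
by case: (Iind F G finF finG FI GI FG).
Qed.

(** The two combinations are almost disjoint from [x] and [y], whose union is cofinite, so they meet
    in a finite set. By independence some member occurs in them with opposite signs. *)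
Lemma avoids_conflict (eps : seq bool) x y a b j : 
  (forall n, j <= n -> x n || y n) ->
  avoids eps x a j -> avoids eps y b j ->
  exists k l, [/\ k \in iota 0 (size eps), l \in iota 0 (size eps),
    nth false eps k <> nth false eps l & a k = b l].
Proof.
move=> xy [aI asep aav] [bI bsep bav]; apply: contrapT => none.
have [_ ind] := indI.
pose S (e : bool) (c : nat -> nat -> bool) : set (set nat) :=
  (fun k => [set n | c k n]) @` [set k | k < size eps /\ nth false eps k = e].
have finS e c : finite_set (S e c).
  by apply: finite_image; apply: (@bounded_finite _ (size eps)) => k [].
have SI e (c : nat -> nat -> bool) : (forall i, i < size eps -> I [set n | c i n]) -> S e c `<=` I.
  by move=> cI _ [k [kn _] <-]; exact: cI.
have chi_inj (c d : nat -> bool) : [set n | c n] = [set n | d n] -> c = d.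
  move=> cd; apply: funext => n; apply/idP/idP => h.
    by have : [set n | c n] n by []; rewrite cd.
  by have : [set n | d n] n by []; rewrite -cd.
apply: (ind (S true a `|` S true b) (S false a `|` S false b)).
- by rewrite finite_setU; split.
- by rewrite finite_setU; split.
- by move=> z [] /SI; apply.
- by move=> z [] /SI; apply.
- apply/seteqP; split=> // z [[] [k [kn ke] <-] [] [l [ln le]] /chi_inj].
  + by move=> e; apply: (asep l k) => //; rewrite ke le.
  + by move=> e; case: none; exists k, l; rewrite !mem_iota ke le.
  + by move=> e; case: none; exists l, k; rewrite !mem_iota ke le.
  + by move=> e; apply: (bsep l k) => //; rewrite ke le.
- apply: (@bounded_finite _ j) => n [nT nF]; rewrite ltnNge; apply/negP => jn.
  have val (c : nat -> nat -> bool) : (forall k, k < size eps -> nth false eps k = true -> c k n) ->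
      (forall k, k < size eps -> nth false eps k = false -> ~ c k n) ->
      forall i, i < size eps -> c i n = nth false eps i.
    by move=> cT cF i ie; case e: (nth false eps i); [exact: cT|apply/negP; exact: cF].
  have /orP[xn|yn] := xy n jn.
    apply: (aav n jn xn); apply: val => k kn ke.
      by apply: (nT [set n | a k n]); left; exists k.
    by apply: (nF [set n | a k n]); left; exists k.
  apply: (bav n jn yn); apply: val => k kn ke.
    by apply: (nT [set n | b k n]); right; exists k.
  by apply: (nF [set n | b k n]); right; exists k.
Qed.

Lemma avoidsW eps x a j l : j <= l -> avoids eps x a j -> avoids eps x a l.
Proof. by move=> jl [aI asep aav]; split=> // n /(leq_trans jl); exact: aav. Qed.

Variable Phi : (nat -> bool * (nat * W)) -> Prop.
Hypotheses (clPhi : sclosed Phi)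
  (PhiI : forall x : nat -> bool,
     I [set n | x n] <-> exists f, Phi (fun k => (x k, f k))).

Let member (u : nat -> bool * (bool * (nat * W))) (i k : nat) : bool := (u (slot i k)).2.1.

(** All members of [I] used by [avoids] and their witnesses for [Phi] are stored in
    the slots of one sequence; members with different signs differ below [m]. *)
Let encodes (eps : seq bool) (j m : nat) (u : nat -> bool * (bool * (nat * W))) : Prop :=
  (forall i, i < size eps -> Phi (fun k => (u (slot i k)).2)) /\
  ((forall p : nat * nat, p.1 < size eps -> p.2 < size eps ->
      nth false eps p.1 <> nth false eps p.2 ->
      ~ agree m (member u p.1) (member u p.2)) /\
   (forall n, j <= n -> (u n).1 ->
      ~ forall i, i < size eps -> member u i n = nth false eps i)).

Let sclosed_encodes eps j m : sclosed (encodes eps j m).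
Proof.
apply: sclosed_and.
  apply: sclosed_forall => i; apply: sclosed_imp.
  exact: (@sclosed_comp _ _ (slot i) snd).
apply: sclosed_and.
  apply: sclosed_forall => p; do 3 apply: sclosed_imp.
  pose N := (\max_(k < m) maxn (slot p.1 k) (slot p.2 k)).+1.
  have slotN k : k < m -> slot p.1 k < N /\ slot p.2 k < N.
    pose ms (k : 'I_m) := maxn (slot p.1 k) (slot p.2 k).
    move=> km; have := leq_bigmax (F := ms) (Ordinal km).
    by rewrite geq_max => /andP[].
  apply: (@sclosed_local _ _ N) => u v uv; apply: contra_not => vv k km.
  have [N1 N2] := slotN k km.
  by rewrite /member !uv //; exact: vv.
apply: sclosed_forall => n; apply: sclosed_imp.
pose N := (maxn n (\max_(i < size eps) slot i n)).+1.
have slotN i : i < size eps -> slot i n < N.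
  move=> ie; rewrite ltnS leq_max; apply/orP; right.
  exact: (leq_bigmax (F := fun i : 'I_(size eps) => slot i n) (Ordinal ie)).
apply: (@sclosed_local _ _ N) => u v uv uP; rewrite -uv ?ltnS ?leq_maxl // => /uP.
by apply: contra_not => vv i ie; rewrite /member uv ?slotN //; exact: vv.
Qed.

Let encodes_avoids eps j m x f : encodes eps j m (fun k => (x k, f k)) ->
  avoids eps x (fun i k => (f (slot i k)).1) j.
Proof.
move=> [uP [usep uav]]; split=> [i ie|i l ie le il eil|n jn xn].
- apply/PhiI; exists (fun k => (f (slot i k)).2).
  rewrite (_ : (fun k => _) = (fun k => f (slot i k))); first exact: (uP i ie).
  by apply: funext => k; case: (f _).
- apply: (usep (i, l) ie le il) => k _; exact: (congr1 (fun h => h k) eil).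
- exact: (uav n jn xn).
Qed.

Let avoids_encodes eps x a j : avoids eps x a j ->
  exists m f, encodes eps j m (fun k => (x k, f k)).
Proof.
move=> [aI asep aav].
have /choice[w wP] : forall i, exists f, i < size eps -> Phi (fun k => (a i k, f k)).
  move=> i; have [ie|ie] := pselect (i < size eps); last 
    by have [w0] := omega1_inhabited RW; exists (fun=> (0, w0)).
  by have [f fP] := (PhiI (a i)).1 (aI i ie); exists f.
have /choice[d dP] : forall p : 'I_(size eps) * 'I_(size eps), exists k,
    nth false eps p.1 <> nth false eps p.2 -> a p.1 k <> a p.2 k.
  move=> [i l] /=; have [il|il] := pselect (nth false eps i <> nth false eps l); last by exists 0.
  apply: contrapT => none; apply: (asep i l (ltn_ord i) (ltn_ord l) il).
  by apply: funext => k; apply: contrapT => ail; apply: none; exists k.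
have [f fE] : exists f, forall i k, f (slot i k) = (a i k, w i k).
  by exists (fun c => let: (i, k) := unslot c in (a i k, w i k)) => i k; rewrite slotK.
exists (\max_p d p).+1, f; split; [|split].
- move=> i ie; rewrite (_ : (fun k => _) = (fun k => (a i k, w i k))); first exact: wP.
  by apply: funext => k; rewrite fE.
- move=> [i l] /= ie le il ag; apply: (dP (Ordinal ie, Ordinal le) il).
  have := ag (d (Ordinal ie, Ordinal le)); rewrite /member /= !fE; apply.
  by rewrite ltnS; exact: leq_bigmax.
- move=> n jn xn; rewrite /member; have := aav n jn xn; apply: contra_not => all_i i ie.
  by have := all_i i ie; rewrite /= fE.
Qed.

Lemma maximal_independent_not_suslin : ~ maximal_independent_family I.
Proof.
move=> Imax.
pose H (p : seq bool * nat * nat) : set (nat -> bool) :=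
  [set x | exists f, encodes p.1.1 p.1.2 p.2 (fun k => (x k, f k))].
pose cover (q : bool * (seq bool * nat * nat)) : set (nat -> bool) :=
  [set x | H q.2 (fun k => x k (+) q.1)].
(* There are countably many parameters, so the set of some parameter or its image under
   complementation is nonmeager. *)
have [||[b p] nH] := @nonmeager_cover MA W R RW _ cover.
- by apply: small_countable => //; exact: countableP.
- move=> x; have [eps [a [j [/avoids_encodes|/avoids_encodes]]]] := avoids_cover x Imax.
    move=> [m [f fP]]; exists (false, (eps, j, m)); exists f.
    by rewrite (_ : (fun k => _) = (fun k => (x k, f k))) //; apply: funext => k; rewrite addbF.
  by move=> [m [f fP]]; exists (true, (eps, j, m)); exists f.
have {}nH : ~ meager W (H p).
  by move=> mH; apply: nH; exact: (meager_flip (fun=> b) mH).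
case: p nH => [[eps j] m] nH.
have smallK : small R (bool * (nat * W)).
  apply: small_prod => //; last exact: small_witness.
  by apply: small_countable => //; exact: countableP.
have [x0 [n0 mx]] := suslin_comeager RW smallK (@sclosed_encodes eps j m) (fun=> iff_refl _) nH.
(* Each [k] chooses at most one [i], the first column of row [k] containing a one. Beyond [n0],
   [theta i x] omits exactly the numbers choosing [i], so two of these sets have cofinite union. *)
pose chosen (x : nat -> bool) k i := x (slot k i) && all (fun l => ~~ x (slot k l)) (iota 0 i).
pose theta i (x : nat -> bool) k := if k < n0 then x0 k else ~~ chosen x k i.
have chosen_uniq x k i l : chosen x k i -> chosen x k l -> i = l.
  wlog : i l / i < l => [th ci cl|il /andP[ci _] /andP[_ /allP/(_ i)]].
    case: (ltngtP i l) => // il; [exact: th|symmetry; exact: th].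
  by rewrite mem_iota /= il ci => /(_ isT).
have mtheta i : meager W (theta i @^-1` [set y | agree n0 x0 y /\ ~ H (eps, j, m) y]).
  apply: meager_preimage mx => [x n|x n].
    exists (\max_(k < n) \max_(l < i.+1) slot k l).+1 => y xy k kn.
    have xys l : l <= i -> x (slot k l) = y (slot k l).
      move=> li; apply: xy; rewrite ltnS.
      apply: leq_trans (leq_bigmax (F := fun k : 'I_n => \max_(l < i.+1) slot k l) (Ordinal kn)).
      exact: (leq_bigmax (F := fun l : 'I_i.+1 => slot k l) (Ordinal (li : l < i.+1))).
    rewrite /theta; case: ifP => // _; rewrite /chosen xys //; congr (~~ (_ && _)).
    by apply: eq_in_all => l; rewrite mem_iota /= => /ltnW/xys->.
  pose x1 k := if k < n then x k else false.
  exists x1; first by move=> k kn; rewrite /x1 kn.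
  pose M := maxn n n0; exists M => z x1z.
  (* Rows from [M] on lie wholly beyond the fixed prefix; each gets a one in column [i] exactly
     where [z] is false. This realises [z] as [theta i t]. *)
  pose t c := if c < n then x c else
    let: (k, l) := unslot c in [&& M <= k, l == i & ~~ z k].
  exists t; first by move=> k kn; rewrite /t kn.
  apply: funext => k; have [kM|Mk] := ltnP k M.
    rewrite -x1z // /theta; case: ifP => // _; congr (~~ _).
    have tE l : t (slot k l) = x1 (slot k l).
      by rewrite /t /x1 slotK [M <= k]leqNgt kM.
    by rewrite /chosen tE; congr (_ && _); apply: eq_all => l; rewrite tE.
  have [nk n0k] : n <= k /\ n0 <= k by apply/andP; rewrite -geq_max.
  have tE l : t (slot k l) = (l == i) && ~~ z k.
    by rewrite /t slotK Mk ltnNge (leq_trans nk (slot_geq k l)).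
  rewrite /theta ltnNge n0k /= /chosen tE eqxx /=.
  rewrite (_ : all _ _ = true) ?andbT ?negbK //.
  by apply/allP => l; rewrite mem_iota tE /= => li; rewrite ltn_eqF.
have small_nat := small_countable RW (@countableP nat _).
(* A single generic [y] puts all the sets [theta i y] into the comeager part of the box at once. *)
have [y _ Hy] := meager_generic RW MA x0 0 (meager_bigcup RW small_nat mtheta).
have {}Hy i : exists a, avoids eps (theta i y) a (maxn j n0).
  have [f fP] : H (eps, j, m) (theta i y).
    apply: contrapT => nHy; apply: Hy; exists i => //; split => // k kn.
    by rewrite /theta kn.
  by exists (fun i k => (f (slot i k)).1); apply: avoidsW (encodes_avoids fP); exact: leq_maxl.
have /choice[a aP] := Hy.
apply: (@finite_incompatible _ (nth false eps) a (iota 0 (size eps)) setT).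
- exact: infinite_nat.
- move=> i k l _; rewrite !mem_iota /= => kn ln kl; have [_ + _] := aP i; exact.
- move=> i l _ _ il; apply: (avoids_conflict _ (aP i) (aP l)) => n.
  rewrite geq_max => /andP[_ nn]; rewrite /theta ltnNge nn /= -negb_and.
  by apply/negP => /andP[ci cl]; apply: il; exact: chosen_uniq ci cl.
Qed.

End MaximalIndependent.

Lemma no_Sigma12_maximal_independent_family : MA_omega1 ->
  ~ exists I : set (set nat), Sigma12_family I /\ maximal_independent_family I.
Proof.
move=> MA [I [SI Imax]]; have [W [R RW]] := exists_omega1.
have [Phi cl PhiI] := Sigma12_family_suslin RW SI.
by apply: (maximal_independent_not_suslin MA RW Imax.1 cl PhiI).
Qed.

(** * Hamel bases *)

Local Open Scope ring_scope.

(** * Fast Cauchy sequences and binary expansions *)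

Section DyadicApproximation.
Variable F : realType.
Implicit Types (h : F) (k l m n : nat).

Definition dyadic (k : nat) : F := 2^-1 ^+ k.

Lemma dyadic_gt0 k : 0 < dyadic k.
Proof. by rewrite exprn_gt0 // invr_gt0 ltr0n. Qed.

Lemma dyadicS k : dyadic k = dyadic k.+1 + dyadic k.+1.
Proof. by rewrite /dyadic exprS; lra. Qed.

Lemma dyadic_leq k l : (k <= l)%N -> dyadic l <= dyadic k.
Proof.
move=> /subnKC<-; elim: (l - k)%N => [|n IH]; first by rewrite addn0.
by apply: le_trans IH; rewrite [leRHS]dyadicS addnS lerDl ltW ?dyadic_gt0.
Qed.

Lemma dyadic_ratr k : dyadic k = ratr (2^-1 ^+ k).
Proof. by rewrite rmorphXn fmorphV /= ratr_nat. Qed.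

Lemma dyadic_lt (x : F) : 0 < x -> exists k, dyadic k < x.
Proof.
move=> x0; have := truncnS_gt x^-1; set n := (Num.truncn _).+1 => xn.
exists n; rewrite /dyadic exprVn -[ltRHS]invrK ltf_pV2 ?posrE ?invr_gt0 ?exprn_gt0 //.
by apply: lt_trans xn _; rewrite -natrX ltr_nat ltn_expl.
Qed.

Lemma dyadic_small (x M : F) n :
  (forall k, (n <= k)%N -> `|x| <= M * dyadic k) -> x = 0.
Proof.
move=> xM; apply/eqP; apply: contrapT => /negP x0; rewrite -normr_gt0 in x0.
have M0 : 0 < M.
  by have := lt_le_trans x0 (xM n (leqnn _)); rewrite pmulr_lgt0 ?dyadic_gt0.
have [k kx] := dyadic_lt (divr_gt0 x0 M0).
have := xM (maxn n k) (leq_maxl _ _); apply/negP; rewrite -ltNge.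
apply: (@le_lt_trans _ _ (M * dyadic k)).
  by rewrite ler_pM2l // dyadic_leq // leq_maxr.
by rewrite mulrC -ltr_pdivlMr.
Qed.

Lemma dyadic_complete (c : nat -> F) :
  (forall k l, `|c k - c l| <= dyadic k + dyadic l) ->
  exists h, forall k, `|c k - h| <= dyadic k.
Proof.
move=> cc; pose E : set F := [set c k - dyadic k | k in [set: nat]].
have ubE l : ubound E (c l + dyadic l).
  by move=> _ [k _ <-]; have := cc k l; rewrite ler_norml; lra.
exists (sup E) => k.
have lo : c k - dyadic k <= sup E.
  by apply: ub_le_sup; [exists (c 0%N + dyadic 0); exact: ubE|exists k].
have up : sup E <= c k + dyadic k.
  by apply: ge_sup; [exists (c 0%N - dyadic 0); exists 0%N|exact: ubE].
by rewrite ler_norml; lra.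
Qed.

Definition near_rat (m : nat) (c : nat -> rat) : set F :=
  [set h | forall k, (k < m)%N -> `|ratr (c k) - h| <= dyadic k].

Lemma near_rat_names c h : (forall k, `|ratr (c k) - h| <= dyadic k) -> names near_rat c h.
Proof.
move=> ch; split=> [m k _ //|U /nbhs_ballP[e /= e0 eU]].
(* From [k.+2] on the index [k.+1] is available, and two errors of [dyadic k.+1] add up to
   [dyadic k]. *)
have [k ke] := dyadic_lt e0; exists k.+2 => n kn h' h'n; apply: eU.
have := h'n k.+1 kn; have := ch k.+1; rewrite -ball_normE /= !ler_norml ltr_norml.
by have := dyadicS k; lra.
Qed.

Lemma exists_rat_names h : exists c : nat -> rat, forall k, `|ratr (c k) - h| <= dyadic k.
Proof.
suff /choice[c cP] : forall k, exists q : rat, `|ratr q - h| <= dyadic k by exists c.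
move=> k.
have [|q] := @rat_in_itvoo F (h - dyadic k) (h + dyadic k).
  by have := dyadic_gt0 k; lra.
by rewrite in_itv /= => /andP[q1 q2]; exists q; rewrite ler_norml; lra.
Qed.

Definition binary_sum (x : nat -> bool) (k : nat) : F :=
  \sum_(j < k.+1) (if x j then dyadic j else 0).

Lemma binary_sumS x k :
  binary_sum x k.+1 = binary_sum x k + (if x k.+1 then dyadic k.+1 else 0).
Proof. by rewrite /binary_sum big_ord_recr. Qed.

Lemma binary_sum_le x k l : (k <= l)%N ->
  binary_sum x k <= binary_sum x l <= binary_sum x k + dyadic k - dyadic l.
Proof.
move=> /subnKC<-; elim: (l - k)%N => [|n IH]; first by rewrite addn0; lra.
rewrite addnS binary_sumS; have := dyadic_gt0 (k + n).+1; have := dyadicS (k + n).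
by case: ifP; lra.
Qed.

Lemma exists_binary_value : exists rho : (nat -> bool) -> F,
  forall x k, `|binary_sum x k - rho x| <= dyadic k.
Proof.
suff /choice[r rP] : forall x, exists r, forall k, `|binary_sum x k - r| <= dyadic k.
  by exists r.
move=> x.
apply: dyadic_complete => k l.
have := dyadic_gt0 k; have := dyadic_gt0 l.
by case: (leqP k l) => [|/ltnW] /(binary_sum_le x); rewrite ler_norml; lra.
Qed.

Lemma binary_sum_flip x n k : (n <= k)%N ->
  binary_sum (fun j => x j (+) (j == n)) k =
  binary_sum x k + (if x n then - dyadic n else dyadic n).
Proof.
move=> nk; have nk' : (n < k.+1)%N by [].
rewrite /binary_sum (bigD1 (Ordinal nk')) //= [in RHS](bigD1 (Ordinal nk')) //= eqxx addbT.
rewrite (eq_bigr (fun j : 'I_k.+1 => if x j then dyadic j else 0)); last first.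
  by move=> j jn; rewrite (_ : (j == n :> nat) = false) ?addbF //; apply/negbTE.
by case: (x n) => /=; lra.
Qed.

Lemma binary_value_flip (rho : (nat -> bool) -> F) x n :
  (forall x k, `|binary_sum x k - rho x| <= dyadic k) ->
  rho (fun j => x j (+) (j == n)) = rho x + (if x n then - dyadic n else dyadic n).
Proof.
move=> rhoP; apply/eqP; rewrite -subr_eq0; apply/eqP; apply: (@dyadic_small _ 2 n) => k nk.
have := rhoP x k; have := rhoP (fun j => x j (+) (j == n)) k.
by rewrite binary_sum_flip // !ler_norml; case: (x n); lra.
Qed.

End DyadicApproximation.

(** * Coordinates with respect to a Hamel basis *)

Section HamelCoordinates.
Variable F : realType.
Variable H : set F.

Definition comb (s : seq (rat * F)) : F := \sum_(p <- s) ratr p.1 * p.2.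

Lemma comb_cat s t : comb (s ++ t) = comb s + comb t.
Proof. exact: big_cat. Qed.

Lemma comb_scale a s : comb [seq (a * p.1, p.2) | p <- s] = ratr a * comb s.
Proof.
by rewrite /comb big_map mulr_sumr; apply: eq_bigr => p _; rewrite rmorphM mulrA.
Qed.

Lemma sum_regroup (s : seq (rat * F)) (t : seq F) (G : rat * F -> F) :
  uniq t -> (forall p, p \in s -> p.2 \in t) ->
  \sum_(p <- s) G p = \sum_(x <- t) \sum_(p <- s | p.2 == x) G p.
Proof.
move=> ut; elim: s => [|p s IH] st.
  by rewrite big_nil big1 // => x _; rewrite big_nil.
rewrite big_cons IH => [|q qs]; last by apply: st; rewrite inE qs orbT.
have -> : G p = \sum_(x <- t) (if p.2 == x then G p else 0).
  rewrite (bigD1_seq p.2) ?st ?inE ?eqxx //= big1 ?addr0 // => x.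
  by rewrite eq_sym => /negbTE->.
rewrite -big_split; apply: eq_bigr => x _ /=; rewrite big_cons.
by case: ifP => // _; rewrite add0r.
Qed.

Variable h0 : F.
Hypothesis Hh0 : H h0.

Definition off_h0 (s : seq (rat * F)) : Prop := forall p, p \in s -> H p.2 /\ p.2 <> h0.

Lemma off_h0_cat s t : off_h0 s -> off_h0 t -> off_h0 (s ++ t).
Proof. by move=> sH tH p; rewrite mem_cat => /orP[/sH|/tH]. Qed.

Lemma off_h0_scale a s : off_h0 s -> off_h0 [seq (a * p.1, p.2) | p <- s].
Proof. by move=> sH _ /mapP[p /sH pH ->]. Qed.

(** The list [s] may repeat a basis element, so its terms are collected before independence is
    applied. *)
Lemma coordinate0 q s : rat_independent H -> off_h0 s ->
  ratr q * h0 + comb s = 0 -> q = 0.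
Proof.
move=> indH sH sum0; pose t := undup [seq p.2 | p <- s].
have tH x : x \in t -> H x /\ x <> h0.
  by rewrite mem_undup => /mapP[p /sH pH ->].
have h0t : h0 \notin t by apply/negP => /tH[].
pose c x := if x == h0 then q else \sum_(p <- s | p.2 == x) p.1.
have := indH (h0 :: t) c; rewrite /= h0t undup_uniq => /(_ isT).
suff sumE : \sum_(x <- h0 :: t) ratr (c x) * x = 0.
  move=> /(_ _ sumE h0); rewrite /c eqxx; apply; last by rewrite inE eqxx.
  by move=> x; rewrite inE => /orP[/eqP->//|/tH[]].
rewrite -[RHS]sum0 big_cons {1}/c eqxx; congr (_ + _).
rewrite /comb (@sum_regroup _ t) ?undup_uniq //; last first.
  by move=> p ps; rewrite mem_undup; apply/mapP; exists p.
apply: eq_big_seq => x xt.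
rewrite /c; case: (x =P h0) => [xh0|_]; first by rewrite -xh0 xt in h0t.
by rewrite rmorph_sum mulr_suml; apply: eq_bigr => p /eqP->.
Qed.

Definition spanned (r : F) : Prop :=
  exists q s, off_h0 s /\ r = ratr q * h0 + comb s.

Lemma spanned0 : spanned 0.
Proof. by exists 0, [::]; split=> //; rewrite /comb big_nil rmorph0 mul0r addr0. Qed.

Lemma spannedD x y : spanned x -> spanned y -> spanned (x + y).
Proof.
move=> [q [s [sH ->]]] [q' [s' [s'H ->]]]; exists (q + q'), (s ++ s').
by split; [exact: off_h0_cat|rewrite comb_cat rmorphD /=; ring].
Qed.

Lemma spannedZ a x : spanned x -> spanned (ratr a * x).
Proof.
move=> [q [s [sH ->]]]; exists (a * q), [seq (a * p.1, p.2) | p <- s].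
by split; [exact: off_h0_scale|rewrite comb_scale rmorphM /=; ring].
Qed.

Lemma spanned_mem x : H x -> spanned x.
Proof.
move=> Hx; have [->|xh0] := eqVneq x h0.
  by exists 1, [::]; split=> //; rewrite /comb big_nil rmorph1 mul1r addr0.
exists 0, [:: (1, x)]; split=> [p|]; first by rewrite inE => /eqP->; split=> //; apply/eqP.
by rewrite /comb big_seq1 rmorph0 rmorph1 mul0r mul1r add0r.
Qed.

(** If [r] were not spanned, a relation in [H] with [r] added would have coefficient zero at [r],
    since otherwise it could be solved for [r]. The extension would be independent, against
    maximality. *)
Lemma spanned_all r : Hamel_basis H -> spanned r.
Proof.
move=> [indH maxH]; apply: contrapT => nr; apply: (nr); apply: spanned_mem.
rewrite -(maxH (H `|` [set r])); [by right| |by move=> x; left].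
move=> s q us sH sum0.
have qr : r \in s -> q r = 0.
  move=> rs; apply/eqP; apply: contrapT => /negP qr0; apply: nr.
  move: sum0; rewrite (bigD1_seq r) //= => /eqP; rewrite addr_eq0 => /eqP rE.
  have -> : r = ratr (- (q r)^-1) * \sum_(i <- s | i != r) ratr (q i) * i.
    rewrite rmorphN fmorphV mulNr -mulrN -rE mulrA mulVf ?mul1r //.
    by rewrite fmorph_eq0.
  apply: spannedZ; rewrite big_seq_cond.
  apply: (big_ind spanned); [exact: spanned0|exact: spannedD|].
  move=> x /andP[xs xr]; apply: spannedZ; apply: spanned_mem.
  by have [//|xr'] := sH x xs; rewrite xr' eqxx in xr.
have [rs|rs] := boolP (r \in s); last first.
  by apply: indH => // x xs; have [//|xr] := sH x xs; rewrite -xr xs in rs.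
have rem0 : \sum_(x <- [seq x <- s | x != r]) ratr (q x) * x = 0.
  by move: sum0; rewrite (bigD1_seq r) //= qr // rmorph0 mul0r add0r big_filter.
have remq := indH _ q (filter_uniq _ us) _ rem0.
move=> x xs; have [->|xr] := eqVneq x r; first exact: qr.
apply: remq; last by rewrite mem_filter xr.
move=> y; rewrite mem_filter => /andP[yr ys].
by have [//|yr'] := sH y ys; rewrite yr' eqxx in yr.
Qed.

End HamelCoordinates.

Lemma Hamel_basis_nonempty (F : realType) (H : set F) : Hamel_basis H -> H !=set0.
Proof.
move=> [_ maxH]; apply: contrapT => H0; apply: (H0); exists 1.
rewrite -(maxH [set 1]) // => [|x Hx]; last by case: H0; exists x.
move=> [|x [|y s]] q us s1 sum0 z zs //.
  move: zs sum0; rewrite inE => /eqP->; rewrite big_seq1 (s1 x) ?inE ?eqxx // mulr1.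
  by move=> /eqP; rewrite fmorph_eq0 => /eqP.
have xE : x = 1 by apply: s1; rewrite inE eqxx.
have yE : y = 1 by apply: s1; rewrite !inE eqxx orbT.
by move: us; rewrite xE yE /= inE eqxx.
Qed.

(** * The category argument against Suslin Hamel bases *)

Section NoHamelBasis.
Hypothesis MA : MA_omega1.
Variables (W : Type) (R : rel W).
Hypothesis RW : is_omega1 R.
Variables (F : realType) (H : set F) (h0 : F).
Hypotheses (HamelH : Hamel_basis H) (Hh0 : H h0).
Variable Phi : (nat -> rat * (nat * W)) -> Prop.
Hypotheses (clPhi : sclosed Phi)
  (PhiH : forall c h, names (@near_rat F) c h ->
     (H h <-> exists f, Phi (fun k => (c k, f k)))).
Variable rho : (nat -> bool) -> F.
Hypothesis rhoP : forall x k, `|binary_sum F x k - rho x| <= dyadic F k.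

Let d : nat -> F := dyadic F.

Let approx (u : nat -> bool * (rat * (nat * W))) (i k : nat) : F := ratr (u (slot i k)).2.1.

Let total (qs : seq rat) : F := \sum_(i < size qs) `|ratr qs`_i|.

(** [x] belongs to the set with parameters [q, qs, e] when [h0 * rho x] is
    [q * h0] plus a combination with coefficients [qs] of members of [H] at distance
    at least [2^-e] from [h0]; their fast Cauchy names are stored in the slots. *)
Let encodes (q : rat) (qs : seq rat) (e : nat) (u : nat -> bool * (rat * (nat * W))) : Prop :=
  (forall i, (i < size qs)%N -> Phi (fun k => (u (slot i k)).2)) /\
  ((forall i, (i < size qs)%N -> forall p : nat * nat,
      `|approx u i p.1 - approx u i p.2| <= d p.1 + d p.2 /\
      d e - d p.1 <= `|approx u i p.1 - h0|) /\
   (forall k, `|h0 * binary_sum F (fun j => (u j).1) k - ratr q * h0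
                - \sum_(i < size qs) ratr qs`_i * approx u i k|
       <= (`|h0| + total qs) * d k)).

(** The fixed distance coded by [e] replaces the open condition of differing from [h0] by a closed
    one. *)
Let sclosed_encodes q qs e : sclosed (encodes q qs e).
Proof.
apply: sclosed_and.
  apply: sclosed_forall => i; apply: sclosed_imp.
  exact: (@sclosed_comp _ _ (slot i) snd).
apply: sclosed_and.
  apply: sclosed_forall => i; apply: sclosed_imp; apply: sclosed_forall => p.
  apply: (@sclosed_local _ _ (maxn (slot i p.1) (slot i p.2)).+1) => u v uv.
  by rewrite /approx !uv // ltnS ?leq_maxl ?leq_maxr.
apply: sclosed_forall => k.
pose N := (maxn k (\max_(i < size qs) slot i k)).+1.
apply: (@sclosed_local _ _ N) => u v uv.
have -> : binary_sum F (fun j => (u j).1) k = binary_sum F (fun j => (v j).1) k.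
  apply: eq_bigr => j _; rewrite uv // ltnS leq_max.
  by rewrite -ltnS ltn_ord.
rewrite (eq_bigr (fun i : 'I_(size qs) => ratr qs`_i * approx v i k)) // => i _.
rewrite /approx uv // ltnS leq_max; apply/orP; right.
exact: (leq_bigmax (F := fun i : 'I_(size qs) => slot i k) i).
Qed.

Let encodes_comb q qs e x f : encodes q qs e (fun k => (x k, f k)) ->
  exists2 s, off_h0 H h0 s & h0 * rho x = ratr q * h0 + comb s.
Proof.
move=> [fPhi [fcauchy fsum]].
pose c i k := (f (slot i k)).1.
have /choice[h hP] : forall i, exists h, (i < size qs)%N ->
    forall k, `|ratr (c i k) - h| <= d k.
  move=> i; have [iq|niq] := boolP (i < size qs)%N; last by exists 0.
  have [|h hP] := @dyadic_complete F (fun k => ratr (c i k)); last by exists h.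
  by move=> k l; have [] := fcauchy i iq (k, l).
pose s := [seq (qs`_i, h i) | i <- iota 0 (size qs)].
exists s => [p /mapP[i]|].
  rewrite mem_iota /= => iq ->; split=> /=.
    apply/(PhiH (near_rat_names (hP i iq))); exists (fun k => (f (slot i k)).2).
    rewrite (_ : (fun k => _) = (fun k => f (slot i k))); first exact: (fPhi i iq).
    by apply: funext => k; rewrite /c; case: (f _).
  (* At index [e.+2] a name of [h0] would be within a quarter of [d e] of [h0], but at least three
     quarters away. *)
  move=> hi; have [_ /= far] := fcauchy i iq (e.+2, 0%N).
  have := hP i iq e.+2; rewrite hi => near_; have := le_trans far near_.
  have := dyadicS F e; have := dyadicS F e.+1; have := dyadic_gt0 F e.+2.
  by rewrite -/d; lra.
apply/eqP; rewrite -subr_eq0; apply/eqP.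
(* The factor 2 adds the error allowed by [encodes] to the errors [E1] and [E2] of passing to the
   limits. *)
apply: (@dyadic_small _ _ (2 * (`|h0| + total qs)) 0%N) => k _.
have combE : comb s = \sum_(i < size qs) ratr qs`_i * h i.
  by rewrite /comb big_map -{1}(subn0 (size qs)) -/(index_iota 0 _) big_mkord.
have E1 : `|h0 * binary_sum F x k - h0 * rho x| <= `|h0| * d k.
  by rewrite -mulrBr normrM ler_wpM2l.
have E2 : `|\sum_(i < size qs) ratr qs`_i * ratr (c i k) - comb s| <= total qs * d k.
  rewrite combE -sumrB /total mulr_suml; apply: le_trans (ler_norm_sum _ _ _) _.
  by apply: ler_sum => i _; rewrite -mulrBr normrM ler_wpM2l // hP.
have := fsum k; rewrite -/d; move: E1 E2.
rewrite /approx /= !mulrDl mulrDr mulrDl -!mulrA.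
rewrite /c; move: (\sum_(i < _) _) (h0 * binary_sum _ _ _) (h0 * rho x) (comb s) => S1 S2 S3 S4.
move: (`|h0| * d k) (total qs * d k) (ratr q * h0) => A B C.
rewrite !ler_norml; lra.
Qed.

Let exists_encodes x : exists p : rat * seq rat * nat, exists f,
  encodes p.1.1 p.1.2 p.2 (fun k => (x k, f k)).
Proof.
have [q [s [sH xE]]] := @spanned_all F H h0 (h0 * rho x) HamelH.
pose qs := [seq p.1 | p <- s]; pose h i := (nth (0, 0) s i).2.
have sz : size qs = size s by rewrite size_map.
have /choice[c cP] : forall i, exists c : nat -> rat, forall k, `|ratr (c k) - h i| <= d k.
  by move=> i; exact: exists_rat_names.
have hH i : (i < size qs)%N -> H (h i) /\ h i <> h0.
  by rewrite sz => iq; apply: sH; exact: mem_nth.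
have [w0] := omega1_inhabited RW.
have /choice[w wP] : forall i, exists w, (i < size qs)%N -> Phi (fun k => (c i k, w k)).
  move=> i; have [iq|niq] := boolP (i < size qs)%N; last by exists (fun=> (0%N, w0)).
  by have [w wP] := (PhiH (near_rat_names (cP i))).1 (hH i iq).1; exists w.
have /choice[e eP] : forall i, exists e, (i < size qs)%N -> d e <= `|h i - h0|.
  move=> i; have [iq|niq] := boolP (i < size qs)%N; last by exists 0%N.
  have [|e /ltW ?] := @dyadic_lt F `|h i - h0|; last by exists e.
  by rewrite normr_gt0 subr_eq0; apply/eqP; exact: (hH i iq).2.
have [f fE] : exists f, forall i k, f (slot i k) = (c i k, w i k).
  by exists (fun a => let: (i, k) := unslot a in (c i k, w i k)) => i k; rewrite slotK.
exists (q, qs, \max_(i < size qs) e i), f; split; [|split] => /=.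
- move=> i iq; rewrite (_ : (fun k => _) = (fun k => (c i k, w i k))); first exact: wP.
  by apply: funext => k; rewrite fE.
- move=> i iq [k l]; rewrite /approx /= !fE /=.
  have := cP i k; have := cP i l; have := eP i iq.
  have : d (\max_(i < size qs) e i) <= d (e i).
    by apply: dyadic_leq; exact: (leq_bigmax (F := fun i : 'I_(size qs) => e i) (Ordinal iq)).
  move=> de ei cl ck; split.
    by move: cl ck; rewrite !ler_norml; lra.
  have := ler_normD (h i - ratr (c i k)) (ratr (c i k) - h0); rewrite addrA subrK.
  by rewrite (distrC (h i) (ratr _)); lra.
- move=> k; rewrite /approx /=.
  have combE : comb s = \sum_(i < size qs) ratr qs`_i * h i.
    rewrite sz /comb (big_nth (0, 0)) big_mkord; apply: eq_bigr => i _.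
    by rewrite /qs (nth_map (0, 0)).
  have E1 : `|h0 * binary_sum F x k - h0 * rho x| <= `|h0| * d k.
    by rewrite -mulrBr normrM ler_wpM2l.
  have E2 : `|\sum_(i < size qs) ratr qs`_i * ratr (f (slot i k)).1 - comb s| <= total qs * d k.
    rewrite combE -sumrB /total mulr_suml; apply: le_trans (ler_norm_sum _ _ _) _.
    by apply: ler_sum => i _; rewrite -mulrBr normrM ler_wpM2l // fE /= cP.
  move: E1 E2; rewrite xE mulrDl.
  move: (\sum_(i < _) _) (h0 * binary_sum _ _ _) (comb s) => S1 S2 S4.
  move: (`|h0| * d k) (total qs * d k) (ratr q * h0) => A B C.
  by rewrite !ler_norml; lra.
Qed.

Lemma Hamel_basis_not_suslin : False.
Proof.
pose S (p : rat * seq rat * nat) : set (nat -> bool) :=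
  [set x | exists f, encodes p.1.1 p.1.2 p.2 (fun k => (x k, f k))].
have [|[[q qs] e] nS] := @nonmeager_cover MA W R RW _ S _ exists_encodes.
  by apply: small_countable => //; exact: countableP.
have smallK : small R (rat * (nat * W)).
  apply: small_prod => //; last exact: small_witness.
  by apply: small_countable => //; exact: countableP.
have [x0 [n0 mx]] := suslin_comeager RW smallK (@sclosed_encodes q qs e) (fun=> iff_refl _) nS.
have [y xy] := meager_generic RW MA x0 n0
  (meager_setU RW mx (meager_flip (fun j => j == n0) mx)).
move=> /not_orP[/not_andP[//|/contrapT [f yf]] /not_andP[[]|/contrapT [g yg]]].
  by move=> k kn; rewrite ltn_eqF // addbF xy.
have [s sH ys] := encodes_comb yf; have [t tH yt] := encodes_comb yg.
(* Flipping digit [n0] changes [h0 * rho y] by [a * h0], while both values have coordinate [q] at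
   [h0]; this forces [a = 0]. *)
pose a : rat := (if y n0 then - 2^-1 ^+ n0 else 2^-1 ^+ n0).
have aE : ratr a = (if y n0 then - d n0 else d n0).
  by rewrite /a /d dyadic_ratr; case: (y n0); rewrite ?rmorphN.
have := coordinate0 Hh0 HamelH.1 (off_h0_cat sH (off_h0_scale (a := -1) tH)) (q := a).
rewrite comb_cat comb_scale rmorphN1 mulN1r aE => /(_ _)/eqP a0.
have : a = 0.
  apply/eqP; apply: a0; move: yt; rewrite (binary_value_flip _ _ rhoP) -/d mulrDr ys.
  by rewrite (mulrC h0); lra.
by apply/eqP; rewrite /a; case: (y n0); rewrite ?oppr_eq0 expf_eq0 invr_eq0 pnatr_eq0 andbF.
Qed.

End NoHamelBasis.

Lemma no_Sigma12_Hamel_basis (F : realType) : MA_omega1 ->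
  ~ exists H : set F, Sigma12 H /\ Hamel_basis H.
Proof.
move=> MA [H [SH HH]]; have [W [R RW]] := exists_omega1.
have [h0 Hh0] := Hamel_basis_nonempty HH.
have [rho rhoP] := exists_binary_value F.
have [|Phi cl PhiH] := @Sigma12_suslin _ _ RW F rat (@near_rat F) _ H SH.
  by move=> m c c' cc' h ch k km; rewrite -cc' //; exact: ch.
exact: (Hamel_basis_not_suslin MA RW HH Hh0 cl PhiH rhoP).
Qed.

(** * Analytic pieces and linearly ordered towers *)

Local Open Scope nat_scope.

(* Baire category in the square of a closed set [G]: if the closed relations [Q n]
   cover a product of two boxes, then one of them contains a smaller product. *)
Lemma baire_square (B : Type) (G : (nat -> B) -> Prop)
    (Q : nat -> (nat -> B) -> (nat -> B) -> Prop) (u0 v0 : nat -> B) (n0 : nat) :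
  sclosed G ->
  (forall n u v, ~ Q n u v -> exists m, forall u' v',
      agree m u u' -> agree m v v' -> ~ Q n u' v') ->
  G u0 -> G v0 ->
  (forall u v, G u -> G v -> agree n0 u0 u -> agree n0 v0 v -> exists n, Q n u v) ->
  exists n m u1 v1, [/\ G u1, G v1, agree n0 u0 u1, agree n0 v0 v1 &
    forall u v, G u -> G v -> agree m u1 u -> agree m v1 v -> Q n u v].
Proof.
move=> clG clQ Gu0 Gv0 cov; apply: contrapT => none.
pose T := ((nat -> B) * (nat -> B) * nat)%type.
pose ok (s : T) := [/\ G s.1.1, G s.1.2, agree n0 u0 s.1.1 & agree n0 v0 s.1.2].
(* Stage [n] refutes [Q n] on a whole product of boxes; the limit pair refutes every [Q n], against
   [cov]. *)
pose step n (s t : T) := [/\ agree s.2 s.1.1 t.1.1, agree s.2 s.1.2 t.1.2, s.2 < t.2 &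
  forall u v, agree t.2 t.1.1 u -> agree t.2 t.1.2 v -> ~ Q n u v].
have /choice[nx nxP] : forall p : nat * T, exists t, ok p.2 -> ok t /\ step p.1 p.2 t.
  move=> [n [[u v] m]]; have [[/= Gu Gv uu vv]|nok] := pselect (ok (u, v, m)); last first.
    by exists (u, v, m).
  have [[u' [v' [Gu' Gv' uu' vv' nQ]]]|noQ] := pselect (exists u' v', [/\ G u', G v',
      agree (maxn n0 m) u u', agree (maxn n0 m) v v' & ~ Q n u' v']).
    have [k kQ] := clQ _ _ _ nQ; exists (u', v', maxn k m.+1) => _; split; split => //=.
    - exact: agree_trans (agree_leq (leq_maxl _ _) uu').
    - exact: agree_trans (agree_leq (leq_maxl _ _) vv').
    - exact: agree_leq (leq_maxr _ _) uu'.
    - exact: agree_leq (leq_maxr _ _) vv'.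
    - by rewrite leq_max leqnn orbT.
    - move=> a b ua vb; apply: kQ; first exact: agree_leq (leq_maxl _ _) ua.
      exact: agree_leq (leq_maxl _ _) vb.
  case: none; exists n, (maxn n0 m), u, v; split=> // a b Ga Gb ua vb.
  by apply: contrapT => nQ; apply: noQ; exists a, b.
pose s := fix s n := if n is k.+1 then nx (k, s k) else (u0, v0, 0) : T.
have s_ok n : ok (s n) by elim: n => // n IH; have [] := nxP (n, s n) IH.
have s_step n : step n (s n) (s n.+1) by have [] := nxP (n, s n) (s_ok n).
have s_size n : n <= (s n).2.
  by elim: n => // n IH; have [_ _ /(leq_ltn_trans IH)] := s_step n.
have s_agree n k : agree (s n).2 (s n).1.1 (s (n + k)).1.1 /\
    agree (s n).2 (s n).1.2 (s (n + k)).1.2.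
  elim: k => [|k [IH1 IH2]]; first by rewrite addn0.
  have sz : (s n).2 <= (s (n + k)).2.
    elim: {IH1 IH2}k => [|k IH]; first by rewrite addn0.
    by have [_ _ /ltnW h _] := s_step (n + k); rewrite addnS; exact: leq_trans h.
  have [h1 h2 _ _] := s_step (n + k); rewrite addnS.
  by split; [apply: agree_trans IH1 _|apply: agree_trans IH2 _]; exact: agree_leq sz _.
pose u k := (s k.+1).1.1 k; pose v k := (s k.+1).1.2 k.
have su n : agree (s n).2 (s n).1.1 u /\ agree (s n).2 (s n).1.2 v.
  suff main k : k < (s n).2 -> (s n).1.1 k = u k /\ (s n).1.2 k = v k.
    by split=> k /main[].
  move=> kn; rewrite /u /v; case: (leqP n k.+1) => [/subnKC<-|/ltnW/subnKC<-].
    by have [h1 h2] := s_agree n (k.+1 - n); rewrite h1 // h2.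
  have [h1 h2] := s_agree k.+1 (n - k.+1).
  by rewrite h1 ?h2 //; exact: s_size.
have Glim (w : nat -> B) (pr : T -> nat -> B) :
    (forall n, G (pr (s n))) -> (forall n, agree (s n).2 (pr (s n)) w) -> G w.
  move=> Gs sw; apply: contrapT => /clG[n nG]; apply: nG (Gs n).
  exact: agree_leq (s_size n) (agree_sym (sw n)).
have [] := cov u v.
- by apply: (Glim u (fun t => t.1.1)) => n; [have [] := s_ok n|have [] := su n].
- by apply: (Glim v (fun t => t.1.2)) => n; [have [] := s_ok n|have [] := su n].
- have [_ _ h _] := s_ok n0; apply: agree_trans h _.
  exact: agree_leq (s_size n0) (su n0).1.
- have [_ _ _ h] := s_ok n0; apply: agree_trans h _.
  exact: agree_leq (s_size n0) (su n0).2.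
- move=> n; have [_ _ _ nQ] := s_step n; apply: nQ; first exact: (su n.+1).1.
  exact: (su n.+1).2.
Qed.

(** * Kernels of closed sets relative to a sigma-ideal *)

Section Kernel.
Variables (B : Type) (A : set B) (G : set (nat -> B)).
Hypotheses (countableA : countable A) (GA : forall u, G u -> forall k, A (u k)).
Variable sm : set (nat -> B) -> Prop.
Hypotheses (sm0 : sm set0) (smW : forall Z Y, Z `<=` Y -> sm Y -> sm Z)
  (sm_bigcup : forall Z : nat -> set (nat -> B), (forall n, sm (Z n)) -> sm (\bigcup_n Z n)).

Lemma sm_setU Z Y : sm Z -> sm Y -> sm (Z `|` Y).
Proof.
move=> sZ sY; apply: smW (sm_bigcup (Z := fun n => if n is 0 then Z else Y) _).
  by move=> u [Zu|Yu]; [exists 0|exists 1].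
by case.
Qed.

Definition kernel : set (nat -> B) :=
  [set u | G u /\ forall n, ~ sm [set v | G v /\ agree n u v]].

(** With countably many letters there are countably many boxes, so the small boxes have a small
    union. *)
Lemma sm_outside_kernel : sm (G `\` kernel).
Proof.
have [e eA eP] := countable_enum (countable_seqs countableA)
  (ex_intro _ [::] isT : [set s : seq B | all (fun x => `[<A x>]) s] !=set0).
pose Z n := [set v | [/\ G v, mkseq v (size (e n)) = e n &
  sm [set w | G w /\ agree (size (e n)) v w]]].
apply: (smW (Y := \bigcup_n Z n)) => [u [Gu]|].
  move=> /not_andP[//|/existsNP[n /contrapT un]].
  have [|m mE] := eP (mkseq u n).
    by rewrite /= all_map; apply/allP => k _; apply/asboolP; exact: GA.
  by exists m => //; rewrite /Z /= mE size_mkseq.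
apply: sm_bigcup => n; have [[v [_ vn sv]]|none] := pselect (Z n !=set0).
  apply: smW sv => w [Gw wn _]; split => //; apply/agree_mkseq; by rewrite vn.
by apply: smW sm0 => w Zw; apply: none; exists w.
Qed.

Lemma kernel_large u n : kernel u -> ~ sm [set v | kernel v /\ agree n u v].
Proof.
move=> [Gu ul] sk; apply: (ul n); apply: smW (sm_setU sk sm_outside_kernel).
by move=> v [Gv uv]; have [kv|nkv] := pselect (kernel v); [left|right].
Qed.

Lemma kernel_nonempty : ~ sm G -> kernel !=set0.
Proof.
move=> nG; apply: contrapT => k0; apply: nG; apply: smW sm_outside_kernel.
by move=> u Gu; split=> // ku; apply: k0; exists u.
Qed.

Lemma sclosed_kernel : sclosed G -> sclosed kernel.
Proof.
move=> clG; apply: sclosed_and => //; apply: sclosed_forall => n.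
apply: (@sclosed_local _ _ n) => u v uv; apply: contra_not; apply: smW => w [Gw vw].
by split => //; exact: agree_trans (agree_sym uv) vw.
Qed.

End Kernel.

Section Pieces.
Variables (W : Type) (R : rel W).
Hypothesis RW : is_omega1 R.
Variable X : set (set nat).
Variable Phi : (nat -> bool * (nat * W)) -> Prop.
Hypotheses (clPhi : sclosed Phi)
  (PhiX : forall x : nat -> bool,
     X [set n | x n] <-> exists f, Phi (fun k => (x k, f k))).

Definition carrier (u : nat -> bool * (nat * W)) : set nat := [set n | (u n).1].

(** Restricting witnesses to countable ordinals bounded by [al] gives an analytic set;
    these sets cover [X] as [al] varies. *)
Definition piece (al : W) : set (nat -> bool * (nat * W)) :=
  [set u | Phi u /\ forall k, R (u k).2.2 al].

Definition letters (al : W) : set (bool * (nat * W)) := [set b | R b.2.2 al].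

Lemma countable_letters al : countable (letters al).
Proof.
apply: (@subset_countable _ _ ([set: bool] `*` ([set: nat] `*` [set v | R v al]))).
  by move=> [b [n v]].
by apply: countableX => //; apply: countableX => //; case: RW.
Qed.

Lemma piece_letters al u : piece al u -> forall k, letters al (u k).
Proof. by move=> []. Qed.

Lemma sclosed_piece al : sclosed (piece al).
Proof.
apply: sclosed_and => //; apply: sclosed_forall => k.
by apply: (@sclosed_local _ _ k.+1) => u v uv; rewrite uv.
Qed.

Lemma piece_mem al u : piece al u -> X (carrier u).
Proof.
move=> [Pu _]; apply/(PhiX (fun k => (u k).1)); exists (fun k => (u k).2).
by rewrite (_ : (fun k => _) = u) //; apply: funext => k; case: (u k).
Qed.

(** A witness mentions only countably many elements of [W], which have a common bound. *)
Lemma piece_cover y : X y -> exists al u, piece al u /\ carrier u = y.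
Proof.
have yE : [set n | `[<y n>]] = y by apply/seteqP; split=> n /asboolP.
rewrite -{1}yE => /PhiX[f Pf].
have [|al alP] := @countable_bounded _ _ RW ((fun k => (f k).2) @` setT).
  exact: countable_image.
exists al, (fun k => (`[<y k>], f k)); split=> //; split=> // k.
by apply: (belowW RW); apply: alP; exists k.
Qed.

End Pieces.

Lemma almost_subset_refl (x : set nat) : almost_subset x x.
Proof. by rewrite /almost_subset setDv. Qed.

Lemma almost_subset_trans (y x z : set nat) :
  almost_subset x y -> almost_subset y z -> almost_subset x z.
Proof.
move=> xy yz; apply: (@sub_finite_set _ _ ((x `\` y) `|` (y `\` z))).
  by move=> n [xn zn]; have [yn|yn] := pselect (y n); [right|left].
by rewrite finite_setU.
Qed.

Lemma sub_almost_subset (x y : set nat) : x `<=` y -> almost_subset x y.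
Proof.
move=> xy; apply: (@sub_finite_set _ _ set0) => // n [xn yn].
exact: yn (xy n xn).
Qed.

Lemma almost_subset_infinite (x y : set nat) :
  infinite_set x -> almost_subset x y -> infinite_set (x `&` y).
Proof.
move=> xinf xy fin; apply: xinf; apply: (@sub_finite_set _ _ ((x `\` y) `|` (x `&` y))).
  by move=> n xn; have [yn|yn] := pselect (y n); [right|left].
by rewrite finite_setU.
Qed.

(** * Analytic pieces of a linearly ordered family *)

Section LinearTower.
Variables (W : Type) (R : rel W).
Hypothesis RW : is_omega1 R.
Variable X : set (set nat).
Variable Phi : (nat -> bool * (nat * W)) -> Prop.
Hypotheses (clPhi : sclosed Phi)
  (PhiX : forall x : nat -> bool,
     X [set n | x n] <-> exists f, Phi (fun k => (x k, f k))).
Hypotheses (X0 : X !=set0) (totX : total_on X almost_subset).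

Let dominated (Z : set (nat -> bool * (nat * W))) : Prop :=
  exists e : nat -> set nat, (forall n, X (e n)) /\
    forall u, Z u -> exists n, almost_subset (e n) (carrier u).

(** Otherwise every box of the kernel is undominated. Two boxes exist between which inclusion holds
    in one direction beyond a fixed bound, and then a single carrier dominates one of them. *)
Lemma piece_coinitial al : dominated (piece R Phi al).
Proof.
apply: contrapT => large.
have sm0 : dominated set0 by case: X0 => x Xx; exists (fun=> x).
have smW Z Y : Z `<=` Y -> dominated Y -> dominated Z.
  by move=> ZY [e [eX eY]]; exists e; split=> // u /ZY/eY.
have smU (Z : nat -> set (nat -> bool * (nat * W))) :
    (forall n, dominated (Z n)) -> dominated (\bigcup_n Z n).
  move=> /choice[e eP]; exists (fun c => e (unslot c).1 (unslot c).2); split.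
    by move=> c; exact: (eP _).1.
  by move=> u [n _ /(eP n).2[m nm]]; exists (slot n m); rewrite slotK.
have cA := countable_letters RW al.
have pA := @piece_letters W R Phi al.
have clK := sclosed_kernel smW (sclosed_piece (R := R) clPhi (al := al)).
have kl := kernel_large cA pA sm0 smW smU.
have [u0 ku0] := kernel_nonempty cA pA sm0 smW smU large.
set K := kernel _ _ in clK kl ku0.
have KX u : K u -> X (carrier u) by move=> [/(piece_mem PhiX)].
(* The parity of [n] gives the direction of the inclusion and [n./2] the point from which it
   holds. *)
pose Q n (u v : nat -> bool * (nat * W)) := forall k, n./2 <= k ->
  if odd n then (u k).1 -> (v k).1 else (v k).1 -> (u k).1.
have [|u v Ku Kv _ _|n [m [u [v [Ku Kv _ _ uvQ]]]]] :=
  @baire_square _ K Q u0 u0 0 clK _ ku0 ku0.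
- move=> n u v /existsNP[k /not_implyP[nk nQ]]; exists k.+1 => u' v' uu vv /(_ k nk).
  by rewrite -uu // -vv.
- have [/finite_bound[n nP]|/finite_bound[n nP]] := totX (KX u Ku) (KX v Kv).
    exists (true + n.*2) => k; rewrite half_bit_double oddD odd_double /= => nk uk.
    by apply: contrapT => vk; have := nP k (conj uk vk); rewrite ltnNge nk.
  exists (false + n.*2) => k; rewrite half_bit_double oddD odd_double /= => nk vk.
  by apply: contrapT => uk; have := nP k (conj vk uk); rewrite ltnNge nk.
- case odn : (odd n).
    apply: (kl v m Kv); exists (fun=> carrier u); split=> [_|w [Kw vw]]; first exact: KX.
    exists 0; apply: (@bounded_finite _ n./2) => k [uk wk]; rewrite ltnNge; apply/negP => nk.
    by have := uvQ u w Ku Kw (agree_refl _) vw k nk; rewrite odn => /(_ uk).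
  apply: (kl u m Ku); exists (fun=> carrier v); split=> [_|w [Kw vw]]; first exact: KX.
  exists 0; apply: (@bounded_finite _ n./2) => k [uk wk]; rewrite ltnNge; apply/negP => nk.
  by have := uvQ w v Kw Kv vw (agree_refl _) k nk; rewrite odn => /(_ uk).
Qed.

End LinearTower.

Lemma finite_inter_total (J : Type) (X : set (set nat)) (B : J -> set nat) (s : seq J) :
  total_on X almost_subset -> (forall j, X (B j)) -> X !=set0 ->
  exists2 x, X x & forall j, List.In j s -> almost_subset x (B j).
Proof.
move=> totX XB [x0 Xx0]; elim: s => [|j s [x Xx xs]]; first by exists x0.
have [xj|jx] := totX x (B j) Xx (XB j).
  by exists x => // i [<-//|]; exact: xs.
exists (B j) => // i [<-|/xs]; first exact: almost_subset_refl.
exact: almost_subset_trans.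
Qed.

Lemma almost_subset_bigcap (J : Type) (B : J -> set nat) (s : seq J) x :
  (forall j, List.In j s -> almost_subset x (B j)) ->
  almost_subset x [set n | forall j, List.In j s -> B j n].
Proof.
elim: s => [|j s IH] xs; first by apply: sub_almost_subset => n _ j [].
have xs' : almost_subset x [set n | forall j, List.In j s -> B j n].
  by apply: IH => i si; apply: xs; right.
apply: (@sub_finite_set _ _ ((x `\` B j) `|`
    (x `\` [set n | forall j, List.In j s -> B j n]))); last first.
  by rewrite finite_setU; split=> //; apply: xs; left.
move=> n [xn nB]; have [jn|] := pselect (B j n); last by left.
by right; split=> // sn; apply: nB => i [<-//|]; exact: sn.
Qed.

Lemma no_Sigma12_ilt : MA_omega1 -> ~ exists X : set (set nat), Sigma12_family X /\ ilt X.
Proof.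
move=> MA [X [SX [Xinf totX noZ]]]; have [W [R RW]] := exists_omega1.
have [Phi cl PhiX] := Sigma12_family_suslin RW SX.
have X0 : X !=set0.
  apply: contrapT => X0; apply: noZ; exists setT; first exact: infinite_nat.
  by move=> x Xx; case: X0; exists x.
have /choice[e eP] := piece_coinitial RW cl PhiX X0 totX.
pose B (p : W * nat) := e p.1 p.2.
have XB p : X (B p) by exact: (eP p.1).1.
have [||z zinf zB] := @pseudointersection MA _ _ RW _ B.
- apply: small_prod => //; first exact: small_omega1.
  by apply: small_countable => //; exact: countableP.
- move=> s; have [x Xx xs] := finite_inter_total s totX XB X0.
  move=> fin; apply: (almost_subset_infinite (Xinf x Xx) (almost_subset_bigcap xs)).
  by apply: sub_finite_set fin => n [].
apply: noZ; exists z => // x /(piece_cover RW PhiX)[al [u [pu <-]]].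
have [n nu] := (eP al).2 u pu.
exact: almost_subset_trans (zB (al, n)) nu.
Qed.

(** * Mad families *)

Section MadFamilies.
Variable A : set (set nat).
Hypothesis madA : mad_family A.

Lemma mad_disjoint a b : A a -> A b -> a <> b -> finite_set (a `&` b).
Proof. by move=> Aa Ab; case: madA => -[_ _ h] _; exact: h. Qed.

Lemma mad_meets (y : set nat) : infinite_set y -> exists2 a, A a & infinite_set (a `&` y).
Proof.
move=> yinf; apply: contrapT => none; have [[Ainf AI aad] maxA] := madA.
have fin a : A a -> finite_set (a `&` y).
  by move=> Aa; apply: contrapT => ay; apply: none; exists a.
have yA : ~ A y by move=> Ay; apply: yinf; rewrite -(setIid y); exact: fin.
apply: yA; rewrite -(maxA (A `|` [set y])) => [||a]; [by right| |by left].
split.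
- by apply: sub_infinite_set Ainf => a; left.
- by move=> a [/AI|->].
- move=> a b [Aa|->] [Ab|->] ab //; [exact: aad|exact: fin|rewrite setIC; exact: fin].
Qed.

(** The sets that are not almost covered by finitely many members of [A]. *)
Definition positive (z : set nat) : Prop :=
  infinite_set [set a | A a /\ infinite_set (a `&` z)].

Lemma infinite_meetW (a y z : set nat) :
  almost_subset z y -> infinite_set (a `&` z) -> infinite_set (a `&` y).
Proof.
move=> zy az fin; apply: az; apply: (@sub_finite_set _ _ ((a `&` y) `|` (z `\` y))).
  by move=> n [an zn]; have [yn|yn] := pselect (y n); [left|right].
by rewrite finite_setU.
Qed.

Lemma positiveW (y z : set nat) : almost_subset z y -> positive z -> positive y.
Proof.
move=> zy; apply: sub_infinite_set => a [Aa az]; split=> //.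
exact: infinite_meetW az.
Qed.

Lemma positive_setT : positive setT.
Proof.
have [[Ainf AI _] _] := madA; apply: sub_infinite_set Ainf => a Aa.
by split=> //; rewrite setIT; exact: AI.
Qed.

Lemma positive_avoid (z : set nat) (l : seq (set nat)) : positive z ->
  exists a, [/\ A a, a \notin l & infinite_set (a `&` z)].
Proof.
move=> /infinite_setD /(_ (finite_seq l)) /infinite_setN0[a [[Aa az] al]].
by exists a; split=> //; apply/negP.
Qed.

(** Some member outside [l] meets [z] infinitely and is almost disjoint from every member of [l]. *)
Lemma positive_difference (z : set nat) (l : seq (set nat)) :
  (forall b, b \in l -> A b) -> positive z ->
  infinite_set [set n | z n /\ forall b, b \in l -> ~ b n].
Proof.
move=> lA /(positive_avoid l)[a [Aa al az]] fin; apply: az.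
apply: (@sub_finite_set _ _ ([set n | z n /\ forall b, b \in l -> ~ b n] `|`
    \bigcup_(b in [set` l]) (a `&` b))).
  move=> n [an zn].
  have [[b bl bn]|nb] := pselect (exists2 b, b \in l & b n); first by right; exists b.
  by left; split=> // b bl bn; apply: nb; exists b.
rewrite finite_setU; split=> //; apply: bigcup_finite; first exact: finite_seq.
move=> b /= bl; apply: mad_disjoint => //; first exact: lA.
by move=> ab; rewrite ab bl in al.
Qed.

Lemma range_infinite (T : Type) (a : nat -> T) : injective a -> infinite_set (range a).
Proof.
move=> ainj; rewrite (eq_finite_set (inj_card_eq _)); first exact: infinite_nat.
by move=> x y _ _; exact: ainj.
Qed.

(* Positive sets form a selective coideal (Mathias): infinitely many members of [A],
   found one after the other, keep the pseudointersection positive. *)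
Lemma positive_pseudointersection (z : nat -> set nat) :
  (forall n, positive [set k | forall i, i <= n -> z i k]) ->
  exists2 y, positive y & forall n, almost_subset y (z n).
Proof.
pose Z n := [set k | forall i, i <= n -> z i k]; move=> pos.
(* The pseudointersection [ay.2] is chosen off all members listed in [l], so a member meeting it
   infinitely is new. *)
have step (l : seq (set nat)) : exists ay : set nat * set nat, (forall b, b \in l -> A b) ->
    [/\ A ay.1, ay.1 \notin l, infinite_set (ay.1 `&` ay.2) & forall n, almost_subset ay.2 (z n)].
  have [lA|nlA] := pselect (forall b, b \in l -> A b); last by exists (set0, set0).
  have /choice[c cP] : forall n, exists k, [/\ Z n k, n <= k & forall b, b \in l -> ~ b k].
    move=> n; have [k [Zk lk] nk] := (infinite_natP _).1 (positive_difference lA (pos n)) n.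
    by exists k.
  have yinf : infinite_set (range c).
    by apply/infinite_natP => n; exists (c n); [exists n|have [] := cP n].
  have [a Aa ay] := mad_meets yinf; exists (a, range c) => _; split=> //=.
    apply/negP => al; have [j [aj [k _ kj]]] := infinite_setN0 ay.
    by have [_ _ /(_ a al)] := cP k; rewrite kj.
  move=> n; apply: (@sub_finite_set _ _ (c @` `I_n)).
    move=> _ [[m _ <-] zm]; exists m => //=; rewrite ltnNge; apply/negP => nm.
    by have [/(_ n nm)] := cP m.
  by apply: finite_image; exact: finite_II.
have /choice[F FP] := step.
pose l := fix l n := if n is k.+1 then (F (l k)).1 :: l k else [::].
have lA n b : b \in l n -> A b.
  elim: n b => //= n IH b; rewrite inE => /orP[/eqP->|]; last exact: IH.
  by have [] := FP (l n) IH.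
pose a n := (F (l n)).1; pose y n := (F (l n)).2.
have aP n : [/\ A (a n), a n \notin l n, infinite_set (a n `&` y n) &
    forall m, almost_subset (y n) (z m)] by exact: (FP (l n) (lA n)).
have al m n : m < n -> a m \in l n.
  elim: n => // n IH; rewrite ltnS leq_eqVlt [l n.+1]/= inE => /orP[/eqP->|/IH->].
    by rewrite eqxx.
  by rewrite orbT.
have ainj : injective a.
  move=> m n amn; case: (ltngtP m n) => // /al.
    by have [_ /negbTE + _ _] := aP n; rewrite amn => ->.
  by have [_ /negbTE + _ _] := aP m; rewrite amn => ->.
(* Cutting [y n] down to [Z n] removes finitely many points and leaves only the first [n] pieces to
   stick out of [z n]. *)
exists (\bigcup_n (y n `&` Z n)).
  apply: sub_infinite_set (range_infinite ainj) => _ [n _ <-].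
  have [An _ ayn yz] := aP n; split=> // fin; apply: ayn.
  apply: (@sub_finite_set _ _ ((a n `&` \bigcup_n (y n `&` Z n)) `|`
      \bigcup_(i in `I_n.+1) (y n `\` z i))).
    move=> k [ak yk].
    have [Zk|/existsNP[i /not_implyP[ni nzi]]] := pselect (Z n k).
      by left; split=> //; exists n.
    by right; exists i.
  rewrite finite_setU; split=> //.
  by apply: bigcup_finite; [exact: finite_II|move=> i _; exact: yz].
move=> n; apply: (@sub_finite_set _ _ (\bigcup_(i in `I_n) (y i `\` z n))).
  move=> k [[i _ [yk Zk]] zk]; exists i => //=; rewrite ltnNge; apply/negP => ni.
  exact: zk (Zk n ni).
by apply: bigcup_finite; [exact: finite_II|move=> i _; have [_ _ _ yz] := aP i; exact: yz].
Qed.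

Variables (W : Type) (R : rel W).
Hypothesis RW : is_omega1 R.
Variable Phi : (nat -> bool * (nat * W)) -> Prop.
Hypotheses (clPhi : sclosed Phi)
  (PhiA : forall x : nat -> bool,
     A [set n | x n] <-> exists f, Phi (fun k => (x k, f k))).

Let trace (Z : set (nat -> bool * (nat * W))) (y : set nat) : set (set nat) :=
  [set a | infinite_set (a `&` y) /\ exists2 u, Z u & carrier u = a].

Let trace_countableW Z Z' y y' : Z `<=` Z' -> almost_subset y y' ->
  countable (trace Z' y') -> countable (trace Z y).
Proof.
move=> ZZ yy; apply: subset_countable => a [ay [u Zu ua]].
by split; [exact: infinite_meetW ay|exists u => //; exact: ZZ].
Qed.

(** First [y] is made to decide, for every node, whether a positive almost subset can have a
    countable trace. If the trace on [y] stays uncountable, two boxes of the kernel have carriers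
    disjoint beyond a bound. The carriers from the first box cut out a positive subset of [y] with a
    countable trace for the second box, against the decision. *)
Lemma positive_shrink al z : positive z ->
  exists y, [/\ positive y, almost_subset y z & countable (trace (piece R Phi al) y)].
Proof.
move=> posz; pose G := piece R Phi al.
pose node (t : seq (bool * (nat * W))) := [set u | G u /\ mkseq u (size t) = t].
have cA := countable_letters RW al.
have [e _ eP] := countable_enum (countable_seqs cA)
  (ex_intro _ [::] isT : [set s | all (fun b => `[<letters R al b>]) s] !=set0).
pose shrinkable t x := exists y, [/\ positive y, almost_subset y x & countable (trace (node t) y)].
have /choice[nx nxP] : forall p : seq (bool * (nat * W)) * set nat, exists y,
    positive p.2 -> [/\ positive y, almost_subset y p.2 &
      shrinkable p.1 p.2 -> countable (trace (node p.1) y)].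
  move=> [t x]; have [[y [py yx cy]]|nsh] := pselect (shrinkable t x).
    by exists y.
  by exists x => px; split=> //; exact: almost_subset_refl.
pose s := fix s n := if n is k.+1 then nx (e k, s k) else z.
have spos n : positive (s n) by elim: n => // n IH; have [] := nxP (e n, s n) IH.
have sdec m n : m <= n -> almost_subset (s n) (s m).
  elim: n => [|n IH]; first by rewrite leqn0 => /eqP->; exact: almost_subset_refl.
  rewrite leq_eqVlt => /orP[/eqP->|/IH]; first exact: almost_subset_refl.
  by have [_ h _] := nxP (e n, s n) (spos n); exact: almost_subset_trans.
have [|y py ys] := @positive_pseudointersection s.
  move=> n; apply: positiveW (spos n).
  apply: (@sub_finite_set _ _ (\bigcup_(i in `I_n.+1) (s n `\` s i))).
    by move=> k [sk /existsNP[i /not_implyP[ni nsi]]]; exists i.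
  by apply: bigcup_finite; [exact: finite_II|move=> i ni; exact: sdec].
have decided u m x : G u -> ~ countable (trace [set v | G v /\ agree m u v] y) ->
    positive x -> almost_subset x y -> ~ countable (trace [set v | G v /\ agree m u v] x).
  move=> Gu ncy px xy cx; apply: ncy.
  have [|n nE] := eP (mkseq u m).
    by rewrite /= all_map; apply/allP => k _; apply/asboolP; exact: piece_letters Gu k.
  have nodeE : node (e n) = [set v | G v /\ agree m u v].
    rewrite /node nE size_mkseq; apply/seteqP; split=> v [Gv vu]; split=> //.
      by apply/agree_mkseq; rewrite vu.
    by apply/agree_mkseq; exact: agree_sym.
  have [_ _ /= sh] := nxP (e n, s n) (spos n).
  rewrite -nodeE; apply: (trace_countableW (fun _ h => h) (ys n.+1)); apply: sh.
  by exists x; split=> //; [exact: almost_subset_trans (ys n)|rewrite nodeE].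
have [cG|ncG] := pselect (countable (trace G y)); first by exists y; split=> //; exact: (ys 0).
exfalso; pose sm Z := countable (trace Z y).
have sm0 : sm set0 by apply: (@subset_countable _ _ set0) => // a [_ []].
have smW Z Y : Z `<=` Y -> sm Y -> sm Z.
  by move=> ZY; apply: trace_countableW => //; exact: almost_subset_refl.
have smU (Z : nat -> set (nat -> bool * (nat * W))) :
    (forall n, sm (Z n)) -> sm (\bigcup_n Z n).
  move=> sZ; apply: (@subset_countable _ _ (\bigcup_n trace (Z n) y)).
    by move=> a [ay [u [n _ Zu] ua]]; exists n => //; split=> //; exists u.
  by apply: bigcup_countable => // n _; exact: sZ.
have pA := @piece_letters W R Phi al.
have clK := sclosed_kernel smW (sclosed_piece (R := R) clPhi (al := al)).
have kl := kernel_large cA pA sm0 smW smU.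
have out := sm_outside_kernel cA pA sm0 smW smU.
have [u0 ku0] := kernel_nonempty cA pA sm0 smW smU ncG.
rewrite -/G in clK kl out ku0.
have KA u : kernel G sm u -> A (carrier u) by move=> [/(piece_mem PhiA)].
(* If all kernel points had the carrier of [u0], the trace would have at most one element. Boxes of
   length [k.+1] then keep the carriers distinct, hence almost disjoint. *)
have [v0 kv0 [k uvk]] : exists2 v, kernel G sm v & exists k, (u0 k).1 <> (v k).1.
  apply: contrapT => same; apply: (kl u0 0 ku0).
  apply: (@subset_countable _ _ [set carrier u0]) => // _ [_ [v [kv _] <-]].
  apply/seteqP; split=> n /=; rewrite /carrier /=; suff -> : (u0 n).1 = (v n).1 by [];
    by apply: contrapT => uv; apply: same; exists v => //; exists n.
pose Q n (u v : nat -> bool * (nat * W)) := forall k, n <= k -> ~ ((u k).1 /\ (v k).1).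
have [|u v Ku Kv uu vv|n [m [u1 [v1 [Ku1 Kv1 _ _ uvQ]]]]] :=
  @baire_square _ (kernel G sm) Q u0 v0 k.+1 clK _ ku0 kv0.
- move=> n u v /existsNP[j /not_implyP[nj /contrapT uvj]]; exists j.+1 => u' v' uu vv /(_ j nj).
  by rewrite -uu // -vv.
- have [|n nP] := finite_bound (mad_disjoint (KA u Ku) (KA v Kv) _).
    move=> uv; apply: uvk; rewrite uu // vv //; apply/idP/idP => h.
      by have : carrier u k by []; rewrite uv.
    by have : carrier v k by []; rewrite -uv.
  by exists n => j nj /nP; rewrite ltnNge nj.
pose U := \bigcup_(u in [set u | kernel G sm u /\ agree m u1 u]) carrier u.
have px : positive (y `&` U).
  move=> fin; apply: (kl u1 m Ku1); apply: finite_set_countable.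
  apply: sub_finite_set fin => a [ay [u Ku ua]]; subst a; split; first exact: KA Ku.1.
  move=> fin; apply: ay; apply: sub_finite_set fin => j [uj yj].
  by split=> //; split=> //; exists u.
apply: (decided v1 m (y `&` U) Kv1.1 (Kv1.2 m) px).
  by apply: sub_almost_subset => j [].
(* In the second box only points outside the kernel can contribute to the trace on the new set. *)
apply: subset_countable out => a [ay [v [Gv vv] va]].
split; first by apply: infinite_meetW ay; apply: sub_almost_subset => j [].
exists v => //; split=> // Kv; apply: ay; apply: (@bounded_finite _ n) => j.
rewrite -va => -[vj [_ [u [Ku uu] uj]]]; rewrite ltnNge; apply/negP => nj.
exact: (uvQ u v Ku Kv uu vv j nj).
Qed.

Lemma positive_tower : exists z : W -> set nat, forall al,
  [/\ positive (z al), forall be, below R be al -> almost_subset (z al) (z be) &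
      countable (trace (piece R Phi al) (z al))].
Proof.
apply: (@wf_choice _ _ (below R) (fun al z y => [/\ positive y,
    forall be, below R be al -> almost_subset y (z be) &
    countable (trace (piece R Phi al) y)]) (wf_below RW)).
- exact: (inhabits set0).
- by move=> al z z' y zz [py yz cy]; split=> // be ba; rewrite -zz //; exact: yz.
move=> al z zP.
have [y py yz] : exists2 y, positive y & forall be, below R be al -> almost_subset y (z be).
  have [[b0 b0al]|none] := pselect (exists be, below R be al); last first.
    by exists setT; [exact: positive_setT|move=> be ba; case: none; exists be].
  have cal : countable [set be | below R be al].
    apply: (@subset_countable _ _ [set be | R be al]); last by case: RW.
    by move=> be /(belowW RW).
  have [e eal eP] := countable_enum cal (ex_intro _ b0 b0al).
  have [|y py ye] := @positive_pseudointersection (z \o e).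
    move=> n.
    (* The largest of finitely many earlier indices gives a positive set almost included in all the
       others. *)
    have [be ba beP] : exists2 be, below R be al &
        forall i, i <= n -> almost_subset (z be) (z (e i)).
      elim: n => [|n [be ba IH]].
        by exists (e 0); [exact: eal|move=> i; rewrite leqn0 => /eqP->; exact: almost_subset_refl].
      have [[_ zbe _] [_ zen _]] := (zP be ba, zP (e n.+1) (eal _)).
      have [le|nle] := boolP (R be (e n.+1)).
        have ze : almost_subset (z (e n.+1)) (z be).
          have [ge|/negP nge] := boolP (R (e n.+1) be); last exact: zen.
          by rewrite (omega1_anti RW le ge); exact: almost_subset_refl.
        exists (e n.+1); first exact: eal.
        move=> i; rewrite leq_eqVlt => /orP[/eqP->|/IH]; first exact: almost_subset_refl.
        exact: almost_subset_trans.
      exists be => // i; rewrite leq_eqVlt => /orP[/eqP->|/IH//].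
      by apply: zbe; exact/negP.
    have [pbe _ _] := zP be ba; apply: positiveW pbe.
    apply: (@sub_finite_set _ _ (\bigcup_(i in `I_n.+1) (z be `\` z (e i)))).
      by move=> k [sk /existsNP[i /not_implyP[ni nsi]]]; exists i.
    by apply: bigcup_finite; [exact: finite_II|move=> i ni; exact: beP].
  by exists y => // be /eP[n <-]; exact: ye.
have [x [px xy cx]] := positive_shrink al py.
by exists x; split=> // be ba; exact: almost_subset_trans xy (yz be ba).
Qed.

Hypothesis MA : MA_omega1.

Lemma mad_not_suslin : False.
Proof.
have [z zP] := positive_tower.
have zR al be : R be al -> almost_subset (z al) (z be).
  move=> le; have [_ zal _] := zP al.
  have [ge|/negP nge] := boolP (R al be); last exact: zal.
  by rewrite (omega1_anti RW le ge); exact: almost_subset_refl.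
have [a0 [Aa0 _ _]] := positive_avoid [::] positive_setT.
have /choice[e eP] : forall al, exists e : nat -> set nat, (forall n, A (e n)) /\
    forall a, trace (piece R Phi al) (z al) a -> exists n, e n = a.
  move=> al; have [_ _ ctr] := zP al.
  have [||e eA et] := @countable_enum _ (trace (piece R Phi al) (z al) `|` [set a0]).
  - exact: countable_setU.
  - by exists a0; right.
  exists e; split=> [n|a ta]; last by apply: et; left.
  by have [[_ [u /(piece_mem PhiA) Au <-//]]|->] := eA n.
(* A pseudointersection is sought that also almost avoids the countably many members in each trace,
   listed by [e]. *)
pose B (j : W + W * nat) := match j with inl al => z al | inr p => ~` e p.1 p.2 end.
have [||y yinf yB] := @pseudointersection MA _ _ RW _ B.
- apply: small_sum => //; first exact: small_omega1.
  apply: small_prod => //; first exact: small_omega1.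
  by apply: small_countable => //; exact: countableP.
- move=> s.
  have [al [l sP]] : exists al (l : seq (set nat)), forall j, List.In j s ->
      match j with inl be => almost_subset (z al) (z be) | inr p => e p.1 p.2 \in l end.
    elim: s => [|j s [al [l IH]]].
      by have [w0] := omega1_inhabited RW; exists w0, [::].
    case: j => [be|p].
      case: (omega1_total RW al be) => [le|ge].
        exists be, l => j [<-|/IH]; first exact: almost_subset_refl.
        by case: j => // ga; exact: almost_subset_trans (zR _ _ le).
      by exists al, l => j [<-|/IH//]; exact: zR.
    exists al, (e p.1 p.2 :: l) => j [<-|/IH]; first by rewrite inE eqxx.
    by case: j => // q ql; rewrite inE ql orbT.
  have [pal _ _] := zP al; have [a [Aa al' az]] := positive_avoid l pal.
  have aB j : List.In j s -> almost_subset (a `&` z al) (B j).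
    move=> /sP; case: j => [be|p] /=.
      by apply: almost_subset_trans; apply: sub_almost_subset => n [].
    move=> pl; rewrite /almost_subset setDE setCK -setIA.
    apply: (@sub_finite_set _ _ (a `&` e p.1 p.2)) => [n [an [_ en]]//|].
    apply: mad_disjoint => //; first exact: (eP _).1.
    by move=> ae; rewrite ae pl in al'.
  move=> fin; apply: (almost_subset_infinite az (almost_subset_bigcap aB)).
  by apply: sub_finite_set fin => n [].
(* A member meeting [y] infinitely lies in some piece [al] and meets [z al] infinitely, so it is
   listed by [e al]; but [y] almost avoids it. *)
have [a Aa ay] := mad_meets yinf.
have [al [u [pu ua]]] := piece_cover RW PhiA Aa.
have [|n na] := (eP al).2 a.
  by split; [apply: infinite_meetW ay; exact: (yB (inl al))|exists u].
have := yB (inr (al, n)); rewrite /almost_subset /= setDE setCK na setIC; exact: ay.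
Qed.

End MadFamilies.

Lemma no_Sigma12_mad : MA_omega1 ->
  ~ exists A : set (set nat), Sigma12_family A /\ mad_family A.
Proof.
move=> MA [A [SA madA]]; have [W [R RW]] := exists_omega1.
have [Phi cl PhiA] := Sigma12_family_suslin RW SA.
exact: (mad_not_suslin madA RW cl PhiA MA).
Qed.

Theorem theorem5p12 (R : realType) (MA : MA_omega1) :
  [/\ ~ (exists X : set (set nat), Sigma12_family X /\ ilt X),
      ~ (exists A : set (set nat), Sigma12_family A /\ mad_family A),
      ~ (exists I : set (set nat),
           Sigma12_family I /\ maximal_independent_family I),
      ~ (exists H : set R, Sigma12 H /\ Hamel_basis H)
    & ~ (exists U : set (set nat),
           Sigma12_family U /\ nonprincipal_ultrafilter U)].
Proof.
split; [exact: no_Sigma12_ilt|exact: no_Sigma12_mad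
  |exact: no_Sigma12_maximal_independent_family|exact: no_Sigma12_Hamel_basis|].
by have [W [lt omega1]] := exists_omega1; exact: (no_Sigma12_ultrafilter MA omega1).
Qed.
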